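(* Every symmetric word equation is solvable. That is: let $S(A,B)$ be any $A$-positive symmetric generalized word in two letters $A$ and $B$, and let $n\ge 1$. Then for every pair of positive definite $n\times n$ complex Hermitian matrices $B$ and $P$, there exists a positive definite $n\times n$ complex Hermitian matrix $A$ such that $S(A,B)=P$.
   Context: A generalized word (g-word) in two letters $A,B$ is an expression $W(A,B)=A^{p_1}B^{q_1}A^{p_2}B^{q_2}\cdots A^{p_k}B^{q_k}A^{p_{k+1}}$ with $k\ge 0$, in which the exponents are real numbers with $p_i,q_i\neq 0$ for $i=1,\ldots,k$ and $p_{k+1}$ an arbitrary real number. Its reversal is $W^*=A^{p_{k+1}}B^{q_k}A^{p_k}\cdots B^{q_2}A^{p_2}B^{q_1}A^{p_1}$. The g-word is symmetric if it is identical (as a formal expression) to its reversal, i.e. $p_i=p_{k+2-i}$ for $1\le i\le k+1$ and $q_i=q_{k+1-i}$ for $1\le i\le k$. It is $A$-positive if all exponents of $A$ in it are positive. Positive definite means complex Hermitian positive definite. Real powers of positive definite matrices are the primary ones: if $X=UDU^*$ with $U$ unitary and $D$ diagonal with positive diagonal entries, then $X^p=UD^pU^*$ is positive definite. For positive definite matrices $A,B$, $S(A,B)$ denotes the matrix obtained by substituting them for the letters. A symmetric word equation is an equation $S(A,B)=P$ in the positive definite unknown $A$, where $S$ is an $A$-positive symmetric g-word; it is solvable if there is a positive definite solution $A$ for every pair of positive definite $n\times n$ matrices $B,P$. *)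

(* Defs.v *)
From HB Require Import structures.
From mathcomp Require Import all_boot all_order all_algebra.
From mathcomp Require Import complex.
From mathcomp Require Import reals exp.

Set Implicit Arguments.
Unset Strict Implicit.
Unset Printing Implicit Defensive.

Import Order.TTheory GRing.Theory Num.Theory.
Local Open Scope ring_scope.
Local Open Scope complex_scope.
Local Open Scope sesquilinear_scope.

Definition posdefmx (R : realType) (n : nat) (A : 'M[R[i]]_n) : Prop :=
  A \is hermsymmx /\
  forall x : 'cV[R[i]]_n, x != 0 -> 0 < (x^t* *m A *m x) 0 0.

Definition diag_powR (R : realType) (n : nat) (d : 'rV[R[i]]_n) (p : R) :
    'M[R[i]]_n :=
  diag_mx (map_mx (fun z : R[i] => (complex.Re z `^ p)%:C) d).

(* For normal A the library's factorization reads A = V^t* D V with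
   V := spectralmx A unitary, i.e. A = U D U^t* with U := V^t*.
   [mxpowR_unitary] shows that the choice of U and D is immaterial. *)
Definition mxpowR (R : realType) (n : nat) (A : 'M[R[i]]_n) (p : R) :
    'M[R[i]]_n :=
  (spectralmx A)^t* *m diag_powR (spectral_diag A) p *m spectralmx A.

Lemma mxpowR_unitary (R : realType) (n : nat) (U : 'M[R[i]]_n)
    (d : 'rV[R[i]]_n) (p : R) :
  U \is unitarymx ->
  mxpowR (U *m diag_mx d *m U^t*) p = U *m diag_powR d p *m U^t*.
Proof.
move=> Uu; set A := U *m _ *m _.
have UUt : U *m U^t* = 1%:M by apply/unitarymxP.
have UtU : U^t* *m U = 1%:M by apply: mulmx1C.
have An : A \is normalmx.
  apply/orthomx_spectral_subproof; exists (U^t*, d); first by rewrite trmxC_unitary.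
  by rewrite /= invmx_unitary ?trmxC_unitary// trmxCK.
have EA := orthomx_spectralP An; have Vu := spectral_unitarymx A.
rewrite invmx_unitary// in EA; rewrite /mxpowR.
move: (spectralmx A) (spectral_diag A) EA Vu => V e EA Vu.
have VVt : V *m V^t* = 1%:M by apply/unitarymxP.
have VtV : V^t* *m V = 1%:M by apply: mulmx1C.
pose W := V *m U.
have WE : W *m diag_mx d = diag_mx e *m W.
  have : V *m A *m U = V *m (V^t* *m diag_mx e *m V) *m U by rewrite -EA.
  rewrite /A !mulmxA VVt mul1mx -[_ *m _ *m U^t* *m U]mulmxA UtU mulmx1.
  by rewrite /W -mulmxA.
have WpE : W *m diag_powR d p = diag_powR e p *m W.
  clearbody W; apply/matrixP => i j; have /matrixP/(_ i j) := WE.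
  rewrite /diag_powR !mul_mx_diag !mul_diag_mx !mxE.
  have [->|W0] := eqVneq (W i j) 0; first by move=> _; rewrite mul0r mulr0.
  by rewrite mulrC => /(mulIf W0) ->; rewrite mulrC.
have -> : V^t* *m diag_powR e p *m V = V^t* *m (diag_powR e p *m W) *m U^t*.
  by rewrite /W -!mulmxA UUt mulmx1.
by rewrite -WpE /W !mulmxA VtV mul1mx.
Qed.

(* The formal expression A^p_1 B^q_1 ... A^p_k B^q_k A^p_(k+1), with exponents
   numbered from 0: [gw_A i] is p_(i+1) and [gw_B i] is q_(i+1). *)
Record gexpr (R : realType) := GExpr {
  gw_len : nat;
  gw_A : {ffun 'I_gw_len.+1 -> R};
  gw_B : {ffun 'I_gw_len -> R} }.

(* The last exponent of A is unconstrained. *)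
Definition is_gword (R : realType) (W : gexpr R) : Prop :=
  forall i : 'I_(gw_len W),
    gw_A W (widen_ord (leqnSn (gw_len W)) i) != 0 /\ gw_B W i != 0.

Definition gw_rev (R : realType) (W : gexpr R) : gexpr R :=
  GExpr [ffun i => gw_A W (rev_ord i)] [ffun i => gw_B W (rev_ord i)].

Definition gw_symmetric (R : realType) (W : gexpr R) : Prop := gw_rev W = W.

Definition gw_Apositive (R : realType) (W : gexpr R) : Prop :=
  forall i : 'I_(gw_len W).+1, 0 < gw_A W i.

Definition gw_eval (R : realType) (n : nat) (W : gexpr R)
    (A B : 'M[R[i]]_n) : 'M[R[i]]_n :=
  (\prod_(i < gw_len W)
      (mxpowR A (gw_A W (widen_ord (leqnSn (gw_len W)) i))
         *m mxpowR B (gw_B W i)))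
    *m mxpowR A (gw_A W ord_max).

Lemma gw_symmetricP (R : realType) (W : gexpr R) :
  gw_symmetric W <->
  (forall i, gw_A W (rev_ord i) = gw_A W i) /\
  (forall i, gw_B W (rev_ord i) = gw_B W i).
Proof.
split=> [WE|]; last first.
  case: W => k p q [/= pE qE]; congr (GExpr _ _);
    by apply/ffunP => i; rewrite ffunE.
have AE : forall j, nth 0 (fgraph (gw_A (gw_rev W))) j = nth 0 (fgraph (gw_A W)) j.
  by rewrite WE.
have BE : forall j, nth 0 (fgraph (gw_B (gw_rev W))) j = nth 0 (fgraph (gw_B W)) j.
  by rewrite WE.
by split=> i; [have := AE i | have := BE i]; rewrite !nth_fgraph_ord ffunE.
Qed.

(* Main.v *)
(* Write [S(A)] for [S(A, B)].  On the compact convex set of positive semidefinite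
   matrices of trace at most [M], the variational inequality
   [tr ((S(A) - P) (X - A)) >= 0 for all X] has a solution [A].  The function
   [tr (S(A) A)] is positive for [A <> 0] and homogeneous of degree [1 + s], with
   [s > 0] the sum of the exponents of [A], so for large [M] the solution has
   [tr A < M].  Then [A + e y y^*] is admissible for every [y] and small [e], hence
   [S(A) - P] is positive semidefinite, and it is orthogonal to [A] (compare with
   [X = 0]).  Since [A y = 0] implies [S(A) y = 0] while [S(A) >= P > 0], [A] is
   positive definite, and orthogonality gives [S(A) = P].

   For finitely many test matrices [X] the variational inequality follows from a
   covering theorem of KKM type on the simplex, obtained from Scarf's theorem on
   dominant sets; a compactness argument gives all [X] at once. *)
From mathcomp Require Import all_boot zify.

Set Implicit Arguments.
Unset Strict Implicit.
Unset Printing Implicit Defensive.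

(** * Scarf's theorem *)

Lemma odd_sum (J : finType) (A : {set J}) (f : J -> nat) :
  odd (\sum_(j in A) f j) = odd #|[set j in A | odd (f j)]|.
Proof.
have oddS (g : J -> nat) : odd (\sum_(j in A) g j) = \big[addb/false]_(j in A) odd (g j).
  exact: (big_morph odd oddD).
have -> : #|[set j in A | odd (f j)]| = \sum_(j in A) odd (f j).
  rewrite -sum1_card [RHS](eq_bigr (fun j => if odd (f j) then 1 else 0)).
    by rewrite -big_mkcondr; apply: eq_bigl => j; rewrite inE.
  by move=> j _; case: odd.
by rewrite !oddS; apply: eq_bigr => j _; rewrite oddb.
Qed.

(** * Parity of rainbow colourings *)

Section Colour.
Variables (T I : finType) (col : T -> I).

(** If [E] has all colours, only its unique point of colour [i] qualifies. Otherwise, if some [e]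
    qualifies, [E :\ e] is injectively coloured and [col e] is repeated there by a single [e']; then
    exactly [e] and [e'] qualify. *)
Lemma odd_rainbow_removal (E : {set T}) (i : I) : #|E| = #|I| ->
  odd #|[set e in E | col @: (E :\ e) == ~: [set i]]| = (col @: E == setT).
Proof.
move=> cE; have [colE|colE] := eqVneq (col @: E) setT.
  have inj : {in E &, injective col}.
    by apply/imset_injP; rewrite colE cardsT cE.
  have /imsetP[e eE ie] : i \in col @: E by rewrite colE inE.
  suff -> : [set e in E | col @: (E :\ e) == ~: [set i]] = [set e] by rewrite cards1.
  apply/setP => x; rewrite !inE; apply/andP/eqP => [[xE /eqP/setP cx]|->].
    apply: inj => //; apply/eqP; rewrite -ie; apply/negPn/negP => ne.
    have := cx (col e); rewrite !inE -ie eqxx /= => /negP[].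
    rewrite ie; apply/imsetP; exists e => //; rewrite !inE eE andbT.
    by apply: contraNneq ne => <-; rewrite ie.
  split=> //; apply/eqP/setP => j; rewrite !inE ie.
  apply/imsetP/idP => [[y]|ne].
    rewrite !inE => /andP[ye yE] ->; apply: contraNneq ye => eq.
    exact/eqP/inj.
  have /imsetP[y yE jy] : j \in col @: E by rewrite colE inE.
  exists y => //; rewrite !inE yE andbT; apply: contraNneq ne => <-.
  by rewrite jy.
have [->|[e]] := set_0Vmem [set e in E | col @: (E :\ e) == ~: [set i]].
  by rewrite cards0.
rewrite inE => /andP[eE /eqP ce].
have cE' : #|col @: (E :\ e)| = #|E :\ e|.
  by rewrite ce cardsC1 -cE (cardsD1 e E) eE.
have inj : {in E :\ e &, injective col} by apply/imset_injP/eqP.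
have nie : col e != i.
  apply: contra_neq colE => eie; rewrite -(setD1K eE) imsetU1 ce eie.
  by apply/setP => j; rewrite !inE orbN.
have /imsetP[e' e'E ee'] : col e \in col @: (E :\ e) by rewrite ce !inE.
have := e'E; rewrite !inE => /andP[ne' e'E'].
suff -> : [set e in E | col @: (E :\ e) == ~: [set i]] = [set e; e'].
  by rewrite cards2 eq_sym ne'.
apply/setP => x; rewrite !inE; apply/andP/orP => [[xE /eqP cx]|[/eqP->|/eqP->]].
- apply/orP/negPn/negP; rewrite negb_or => /andP[xe xe'].
  have : col x \in col @: (E :\ x).
    by rewrite cx -ce imset_f// !inE xe.
  case/imsetP => y; rewrite !inE => /andP[yx yE] xy.
  have xE' : x \in E :\ e by rewrite !inE xe.
  have [ye|ye] := eqVneq y e.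
    by move: xe'; rewrite (inj x e') ?eqxx// xy ye.
  by move: yx; rewrite (inj x y) ?eqxx// !inE ye.
- by rewrite eE ce.
- split=> //; rewrite -ce; apply/eqP/setP => j.
  apply/imsetP/imsetP => -[y]; rewrite !inE => /andP[yx yE] ->.
    have [->|ye] := eqVneq y e; first by exists e'.
    by exists y; rewrite // !inE ye.
  have [->|ye] := eqVneq y e'; first by exists e; rewrite // !inE eq_sym ne'.
  by exists y; rewrite // !inE ye.
Qed.

End Colour.

(** * Dominant sets, and the rooms adjoining a door *)

Section Dominance.
Variables (T I : finType) (r : I -> T -> nat).
Hypothesis r_inj : forall i, injective (r i).

(** Equivalently, no point lies strictly above the minimum of [E] in all orders at once. *)
Definition dominant (E : {set T}) :=
  [forall y, exists i, [forall x in E, r i y <= r i x]].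

Lemma dominantP (E : {set T}) :
  reflect (forall y, exists i, forall x, x \in E -> r i y <= r i x) (dominant E).
Proof.
apply: (iffP forallP) => h y; have := h y.
  by case/existsP => i /forall_inP; exists i.
by case=> i hi; apply/existsP; exists i; apply/forall_inP.
Qed.

Lemma dominantS (E F : {set T}) : F \subset E -> dominant E -> dominant F.
Proof.
move=> /subsetP FE /dominantP dE; apply/dominantP => y.
by have [i hi] := dE y; exists i => x /FE /hi.
Qed.

(** If [F] is dominant, such points lie weakly below all of [F] in order [i]: they are the
    candidates for a new least point in that order. *)
Definition above (F : {set T}) i :=
  [set y | [forall k, (k != i) ==> [exists x in F, r k x < r k y]]].

Lemma aboveP (F : {set T}) i y :
  reflect (forall k, k != i -> exists2 x, x \in F & r k x < r k y) (y \in above F i).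
Proof.
rewrite inE; apply: (iffP forall_inP) => h k /h; first by case/exists_inP => x; exists x.
by case=> x xF xy; apply/exists_inP; exists x.
Qed.

(** Only the largest candidate can be added: with a smaller one, the largest would exceed the
    minimum in every order. *)
Definition tops (F : {set T}) i :=
  [set e in above F i | [forall y in above F i, r i y <= r i e]].

Lemma card_tops F i : #|tops F i| = (above F i != set0).
Proof.
have [Y0|[y0 y0Y]] := set_0Vmem (above F i).
  by rewrite Y0 eqxx; apply: eq_card0 => e; rewrite inE Y0 !inE.
have -> : above F i != set0 by apply/set0Pn; exists y0.
have [e eY emax] := arg_maxnP (r i) y0Y.
suff -> : tops F i = [set e] by rewrite cards1.
apply/setP => x; rewrite in_set1.
rewrite in_set; apply/andP/eqP => [[xY /forall_inP xmax]|->].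
  by apply: (r_inj (i := i)); apply/eqP; rewrite eqn_leq xmax ?andbT//; exact: emax.
by split=> //; apply/forall_inP => y /emax.
Qed.

Section Door.
Variable F : {set T}.
Hypotheses (Fdom : dominant F) (F0 : F != set0) (cF : #|F|.+1 = #|I|).

(* The least elements of [F] for the various orders exhaust [F], and exactly
   one of them is least for two orders [i] and [j]: adding a point [e] to [F]
   must relieve one of the two. *)
Lemma door_rooms : exists i j,
  [/\ i != j, [disjoint above F i & above F j],
      [set e | (e \notin F) && dominant (e |: F)] = tops F i :|: tops F j &
      exists2 x, x \in F & (forall z, z \in F -> r i x <= r i z) /\
                           (forall z, z \in F -> r j x <= r j z)].
Proof.
have [x0 x0F] := set0Pn _ F0.
pose m i := [arg min_(x < x0 in F) r i x].
have mF i : m i \in F by rewrite /m; case: arg_minnP.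
have mle i x : x \in F -> r i (m i) <= r i x.
  by rewrite /m; case: arg_minnP => // y _; apply.
have mE i x : x \in F -> (forall z, z \in F -> r i x <= r i z) -> m i = x.
  move=> xF xm; apply: (r_inj (i := i)); apply/eqP.
  by rewrite eqn_leq mle//= xm.
(* Dominance applied to a point of [F] itself gives an order in which that point is least. *)
have msurj : m @: setT = F.
  apply/setP => x; apply/imsetP/idP => [[i _ ->]//|xF].
  have [i hi] := dominantP _ Fdom x; exists i => //; exact/esym/mE.
(* By cardinality [m] takes the same value at some [i] and [j]; off either of them it is a bijection
   onto [F]. *)
have [/injectiveP minj|/injectivePn[i [j ij mij]]] := boolP (injectiveb m).
  have := card_imset setT minj; rewrite msurj cardsT => E.
  by move: cF; rewrite E => /eqP; rewrite eqn_leq ltnn.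
have msurj' i1 j1 : i1 != j1 -> m i1 = m j1 -> m @: [set~ i1] = F.
  move=> ij1 mij1; rewrite -msurj; apply/setP => x.
  apply/imsetP/imsetP => -[k kP ->]; first by exists k.
  have [->|ki] := eqVneq k i1; last by exists k; rewrite // !inE.
  by exists j1; rewrite // !inE eq_sym.
have minj' i1 j1 : i1 != j1 -> m i1 = m j1 -> {in [set~ i1] &, injective m}.
  move=> ij1 mij1; apply/imset_injP; rewrite (msurj' _ j1)// cardsC1 -cF.
  by [].
have aboveE i1 y : (y \in above F i1) = [forall k, (k != i1) ==> (r k (m k) < r k y)].
  apply/aboveP/forall_inP => h k ki; have := h k ki.
    by case=> x xF; apply: leq_ltn_trans; exact: mle.
  by exists (m k).
have topsP i1 j1 e : i1 != j1 -> m i1 = m j1 -> e \in tops F i1 ->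
    (e \notin F) && dominant (e |: F).
  move=> ij1 mij1; rewrite in_set aboveE => /andP[/forall_inP eY /forall_inP emax].
  apply/andP; split.
    apply/negP; rewrite -(msurj' _ _ ij1 mij1) => /imsetP[k].
    by rewrite !inE => ki ek; have := eY k ki; rewrite -ek ltnn.
  apply/dominantP => y; have [yY|] := boolP (y \in above F i1).
    exists i1 => x; rewrite !inE => /orP[/eqP->|xF]; first exact: emax.
    have [k hk] := dominantP _ Fdom y.
    have [ki|ki] := eqVneq k i1; first by rewrite -ki; exact: hk.
    move: yY; rewrite aboveE => /forall_inP/(_ k ki).
    by rewrite ltnNge hk.
  rewrite aboveE => /forall_inPn[k ki]; rewrite -leqNgt => yk.
  exists k => x; rewrite !inE => /orP[/eqP->|xF]; last exact: leq_trans (mle _ _ xF).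
  by apply/ltnW/(leq_ltn_trans yk)/eY.
have inP i1 j1 e : i1 != j1 -> m i1 = m j1 -> e \notin F -> dominant (e |: F) ->
    r j1 (m j1) < r j1 e -> e \in tops F i1.
  move=> ij1 mij1 eF /dominantP deF hj; have eY : e \in above F i1.
    rewrite aboveE; apply/forall_inP => k ki.
    have [->//|kj] := eqVneq k j1.
    (* In some order [k'] the point [m k] stays least after [e] is added; bijectivity off [i1]
       forces [k' = k]. *)
    have [k' hk'] := deF (m k).
    have mk' : m k' = m k.
      by apply: mE => // z zF; apply: hk'; rewrite !inE zF orbT.
    have kk' : k' = k.
      have [kk'|kk'] := eqVneq k' i1; last by apply: (minj' _ _ ij1 mij1); rewrite ?inE.
      move/eqP: kj; case; apply: (minj' _ _ ij1 mij1); rewrite ?inE// 1?eq_sym//.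
      by rewrite -mk' kk' mij1.
    rewrite -kk' ltn_neqAle mk' hk' ?andbT; last by rewrite !inE eqxx.
    by apply: contraNneq eF => /r_inj <-.
  rewrite in_set eY; apply/forall_inP => y; rewrite aboveE => /forall_inP yY.
  have [k hk] := deF y.
  have [<-|ki] := eqVneq k i1; first by apply: hk; rewrite !inE eqxx.
  have : m k \in e |: F by rewrite !inE mF orbT.
  by move=> /hk; rewrite leqNgt yY.
exists i, j; split=> //.
- rewrite -setI_eq0; apply/eqP/setP => y; rewrite in_set0 in_setI.
  apply/negP => /andP[]; rewrite !aboveE => /forall_inP yi /forall_inP yj.
  have [k hk] := dominantP _ Fdom y; have := hk _ (mF k); rewrite leqNgt => /negP[].
  by have [->|ki] := eqVneq k i; [apply: yj | apply: yi].
- apply/setP => e; rewrite in_setU; apply/idP/orP => [|[]]; last 2 first.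
  - by move=> eT; rewrite inE; exact: topsP ij mij eT.
  - by move=> eT; rewrite inE; apply: (topsP _ i) eT; rewrite // eq_sym.
  rewrite inE => /andP[eF deF].
  (* [m i] stays least in one of the orders [i] and [j]; the other one is relieved by [e]. *)
  have [k hk] := dominantP _ deF (m i).
  have mk : m k = m i by apply: mE => // z zF; apply: hk; rewrite !inE zF orbT.
  have mke : r k (m k) < r k e.
    rewrite ltn_neqAle mk hk ?andbT; last by rewrite !inE eqxx.
    by apply: contraNneq eF => /r_inj <-.
  have [ki|ki] := eqVneq k i.
    right; apply: (inP _ i); rewrite // 1?eq_sym//; by rewrite -ki.
  left; apply: (inP _ j) => //.
  suff <- : k = j by [].
  by apply: (minj' _ _ ij mij); rewrite ?inE// 1?eq_sym// mk.
- by exists (m i); rewrite ?mF//; split=> z /mle //; rewrite mij.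
Qed.

End Door.
End Dominance.

(** * Slack points and the parity count *)

Section Scarf.
Variables (X I : finType) (r : I -> X -> nat) (c : X -> I) (x0 : X).
Hypothesis r_inj : forall i, injective (r i).
Hypothesis I_gt1 : 1 < #|I|.

(* A slack point for each [i], least in the order [i] and above all of [X] in
   the other orders. *)
Definition slack_rank (i : I) (t : X + I) : nat :=
  match t with
  | inl x => (r i x).+1
  | inr j => if j == i then 0 else (\max_x r i x).+2 + enum_rank j
  end.

Definition slack_col (t : X + I) : I := match t with inl x => c x | inr j => j end.

(** The successor reserves rank 0 for the slack point of [i], and [enum_rank] separates the other
    slack points. *)
Lemma slack_rank_inj i : injective (slack_rank i).
Proof.
have rmax x : r i x <= \max_x r i x by exact: leq_bigmax.
case=> [x|j] [y|k] //=.
- by move=> [/r_inj ->].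
- by case: eqP => // _; have := rmax x; lia.
- by case: eqP => // _; have := rmax y; lia.
- case: eqP => [->|_]; case: eqP => [->|_] // /eqP.
  by rewrite eqn_add2l => /eqP/ord_inj/enum_rank_inj ->.
Qed.

Let dom := @dominant _ _ slack_rank.
Let abv := @above _ _ slack_rank.

Lemma inl_lt_slack i j x : j != i -> slack_rank i (inl x) < slack_rank i (inr j).
Proof.
move=> /= /negPf ->; have : r i x <= \max_x r i x by exact: leq_bigmax.
by lia.
Qed.

(** The outer door: among the doors coloured by all but [i], the one that adjoins a single room. *)
Definition slacks_but (i : I) : {set X + I} := inr @: [set~ i].

Lemma card_slacks_but i : #|slacks_but i|.+1 = #|I|.
Proof. by rewrite card_imset ?cardsC1 ?prednK//; [lia | move=> ? ? []]. Qed.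

Lemma mem_slacks_but i t :
  (t \in slacks_but i) = if t is inr j then j != i else false.
Proof.
apply/imsetP/idP => [[j] |]; first by rewrite !inE => ? ->.
by case: t => // j ji; exists j; rewrite ?inE.
Qed.

Lemma slacks_but_dominant i : dom (slacks_but i).
Proof.
apply/dominantP => -[x|j].
  exists i => t; rewrite mem_slacks_but; case: t => // j ji.
  exact/ltnW/inl_lt_slack.
by exists j => t _ /=; rewrite eqxx.
Qed.

(** As [inr k] is not above [F], in some order other than [k] no point of [F] is below it. There it
    exceeds all of [X], so [F] consists of slack points. *)
Lemma above_eq0 (F : {set X + I}) i k :
  slack_col @: F = [set~ i] -> #|F|.+1 = #|I| -> abv F k = set0 -> F = slacks_but i.
Proof.
move=> cF sF aF; apply/eqP.
rewrite eqEcard -[_ <= _]ltnS card_slacks_but sF leqnn andbT.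
have : inr k \notin abv F k by rewrite aF inE.
rewrite inE => /forall_inPn[j jk /exists_inPn hj]; apply/subsetP => t tF.
rewrite mem_slacks_but; case: t tF => [x|l] tF.
  by have := hj _ tF; rewrite inl_lt_slack// eq_sym.
have : l \in slack_col @: F by apply/imsetP; exists (inr l).
by rewrite cF !inE.
Qed.

Lemma above_slacks_but i : abv (slacks_but i) i != set0.
Proof.
apply/set0Pn; exists (inl x0); apply/aboveP => k ki.
by exists (inr k); rewrite ?mem_slacks_but//= eqxx.
Qed.

(** The common least point [t] is [inr j]. A point exceeding it in order [i] must be some [inr k];
    it is not [t] itself, and for [k != j] it would have to exceed something in order [k], where it
    has rank 0. *)
Lemma above_slacks_but0 i j t : j != i -> t \in slacks_but i ->
  (forall z, z \in slacks_but i -> slack_rank i t <= slack_rank i z) ->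
  (forall z, z \in slacks_but i -> slack_rank j t <= slack_rank j z) ->
  abv (slacks_but i) j = set0.
Proof.
move=> ji tF mi mj; have tE : t = inr j.
  apply: (slack_rank_inj (i := j)); apply/eqP; rewrite eqn_leq mj ?mem_slacks_but//=.
  by rewrite eqxx.
apply/setP => y; rewrite in_set0; apply/negP => /aboveP ya.
have [z zF zy] : exists2 x, x \in slacks_but i & slack_rank i x < slack_rank i y.
  by apply: ya; rewrite eq_sym.
have {z zF zy}ty := leq_ltn_trans (mi z zF) zy.
case: y ya ty => [y|k] ya ty.
  by move: ty; rewrite tE ltnNge (ltnW (inl_lt_slack _ _)).
have [kj|kj] := eqVneq k j; first by move: ty; rewrite tE kj ltnn.
by have [z _] := ya _ kj; rewrite /= eqxx.
Qed.

(** Each of the two orders given by [door_rooms] contributes one room unless it has no candidate,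
    which makes [F] the outer door. For the outer door one of the two orders is [i], and only that
    one contributes. *)
Lemma odd_door_rooms (F : {set X + I}) i :
  dom F -> #|F|.+1 = #|I| -> slack_col @: F = [set~ i] ->
  odd #|[set e | (e \notin F) && dom (e |: F)]| = (F == slacks_but i).
Proof.
move=> dF sF cF; have F0 : F != set0 by rewrite -card_gt0; lia.
have [a [b [ab dis -> [t tF [mi mj]]]]] := door_rooms slack_rank_inj dF F0 sF.
rewrite cardsU (_ : tops _ _ _ :&: _ = set0); last first.
  apply/eqP; rewrite setI_eq0; apply: disjointWl (disjointWr _ dis);
  by apply/subsetP => x; rewrite in_set => /andP[].
rewrite cards0 subn0 !card_tops; try exact: slack_rank_inj.
rewrite oddD !oddb -/abv; have [FE|FE] := eqVneq F (slacks_but i); last first.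
  have -> : abv F a != set0 by apply: contra_neq FE => /(above_eq0 cF sF).
  by have -> : abv F b != set0 by apply: contra_neq FE => /(above_eq0 cF sF).
rewrite FE in tF mi mj *.
(* In an order other than [i] the least point is its own slack point, so [a] and [b] cannot both
   differ from [i]. *)
have tE k : k != i -> (forall z, z \in slacks_but i -> slack_rank k t <= slack_rank k z) ->
    t = inr k.
  move=> ki mk; apply: (slack_rank_inj (i := k)); apply/eqP.
  by rewrite eqn_leq mk ?mem_slacks_but//= eqxx.
have [ai|ai] := eqVneq a i.
  subst a; rewrite eq_sym in ab.
  by rewrite (above_slacks_but0 ab tF mi mj) (negPf (above_slacks_but i)) !eqxx.
have [bi|bi] := eqVneq b i.
  by subst b; rewrite (above_slacks_but0 ab tF mj mi) (negPf (above_slacks_but i)) !eqxx.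
have := tE _ ai mi; rewrite (tE _ bi mj) => -[ba].
by rewrite ba eqxx in ab.
Qed.

(* Count the pairs of a room [E] and a door [E :\ e] coloured by all but [i]. *)
Lemma rainbow_room : exists E : {set X + I}, dom E /\ slack_col @: E = setT.
Proof.
have /card_gt0P[i _] : 0 < #|I| by lia.
pose rooms := [set E | dom E & #|E| == #|I|].
pose doors := [set F | dom F & (#|F|.+1 == #|I|) && (slack_col @: F == [set~ i])].
have count : \sum_(E in rooms) #|[set e in E | slack_col @: (E :\ e) == [set~ i]]| =
    \sum_(F in doors) #|[set e | (e \notin F) && dom (e |: F)]|.
  under eq_bigr do rewrite -sum1_card.
  under [RHS]eq_bigr do rewrite -sum1_card.
  rewrite !pair_big_dep /=.
  (* A door with an added point is a room with a chosen point, through [E = e |: F]. *)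
  rewrite (reindex_onto (fun p => (p.2 |: p.1, p.2)) (fun p => (p.1 :\ p.2, p.2))) /=.
    apply: eq_bigl => -[F e] /=; rewrite !inE eqxx /=.
    have [eF|eF] := boolP (e \in F); rewrite /= ?andbF.
      suff /negPf -> : ((e |: F) :\ e, e) != (F, e) by rewrite andbF.
      by apply/eqP => -[] /setP/(_ e); rewrite !inE eqxx eF.
    rewrite setU1K// eqxx andbT cardsU1 eF add1n.
    have [deF|] := boolP (dom (e |: F)); rewrite /= ?andbF//.
    by rewrite (_ : dom F) ?andbT//; apply: dominantS deF; exact: subsetUr.
  by move=> [E e] /=; rewrite !inE => /andP[_ /andP[eE _]]; rewrite setD1K.
have := congr1 odd count; rewrite !odd_sum.
(* Only the outer door has an odd number of rooms, so some room has an odd number of doors. *)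
have -> : [set F in doors | odd #|[set e | (e \notin F) && dom (e |: F)]|] =
    [set slacks_but i].
  apply/setP => F; rewrite !inE; apply/andP/eqP => [[/and3P[dF /eqP sF /eqP cF]]|->].
    by rewrite (odd_door_rooms dF sF cF) => /eqP.
  have cS : slack_col @: slacks_but i = [set~ i].
    by rewrite -imset_comp imset_id.
  have [dS sS] := (slacks_but_dominant i, card_slacks_but i).
  by rewrite (odd_door_rooms dS sS cS) dS sS cS !eqxx.
rewrite cards1; have [->|[E]] := set_0Vmem [set E in rooms | odd
    #|[set e in E | slack_col @: (E :\ e) == [set~ i]]|]; first by rewrite cards0.
rewrite !inE => /andP[/andP[dE /eqP sE]]; rewrite odd_rainbow_removal// => /eqP cE _.
by exists E.
Qed.

(** From a rainbow room, [s] takes the points of [X] and [C] the indices whose slack point is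
    absent. A colour in [C] must come from [s]. An order witnessing dominance against a point of [X]
    lies in [C], because a slack point has rank 0 in its own order. *)
Theorem scarf : exists (s : {set X}) (C : {set I}),
  (forall i, i \in C -> exists2 x, x \in s & c x = i) /\
  (forall y, exists2 i, i \in C & forall x, x \in s -> r i y <= r i x).
Proof.
have [E [/dominantP dE cE]] := rainbow_room.
exists [set x | inl x \in E], [set i | inr i \notin E]; split=> [i|y].
  rewrite inE => iE; have /imsetP[[x|j] tE] : i \in slack_col @: E by rewrite cE.
    by move=> ->; exists x; rewrite ?inE.
  by move=> /= ij; rewrite ij tE in iE.
have [i hi] := dE (inl y); exists i => [|x]; rewrite inE.
  by apply/negP => /hi /=; rewrite eqxx.
by move=> /hi.
Qed.

End Scarf.

(** * A covering theorem on the simplex *)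

Section Grid.
Variables (I : finType) (m : nat).
Hypothesis I_gt1 : 1 < #|I|.

Let grid := {f : {ffun I -> 'I_m.+1} | \sum_i f i == m}.

Lemma grid_of (g : I -> nat) : \sum_i g i = m ->
  exists y : grid, forall i, val y i = g i :> nat.
Proof.
move=> sg; have gm i : g i < m.+1.
  by rewrite ltnS -sg (bigD1 i)//= leq_addr.
have sf : \sum_i [ffun i => Ordinal (gm i)] i == m.
  apply/eqP/(etrans _ sg)/eq_bigr => i _; by rewrite ffunE.
by exists (exist _ [ffun i => Ordinal (gm i)] sf) => i /=; rewrite ffunE.
Qed.

(* Scarf's theorem for the coordinate orders. If [mu i] is the least
   [i]-th coordinate over [s], then [\sum_(i in C) (mu i).+1 > m], since otherwise
   some grid point would exceed [mu] at all of [C]; hence [s] is small. *)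
Lemma grid_labels (c : {ffun I -> nat} -> I) : exists v : {ffun I -> nat},
  \sum_i v i = m /\
  forall j, #|I| <= v j -> exists x : {ffun I -> nat},
    [/\ \sum_i x i = m, c x = j & forall k, x k <= v k + #|I| /\ v k <= x k + #|I|].
Proof.
have /card_gt0P[i0 _] : 0 < #|I| by lia.
pose nat_of (x : grid) : {ffun I -> nat} := [ffun i => val x i : nat].
have sumE (x : grid) : \sum_i nat_of x i = m.
  rewrite -[RHS](eqP (valP x)); apply: eq_bigr => i _; by rewrite ffunE.
have [y0 _] : exists y : grid, forall i, val y i = (if i == i0 then m else 0) :> nat.
  by apply: grid_of; rewrite -big_mkcond big_pred1_eq.
(* The order of the [i]-th coordinate, with ties broken by enumeration to make it injective. *)
pose r i (x : grid) := nat_of x i * #|{: grid}| + enum_rank x.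
have r_inj i : injective (r i).
  move=> x y /(congr1 (modn^~ #|{: grid}|)); rewrite /r !modnMDl !modn_small//.
  by move=> /ord_inj/enum_rank_inj.
have rlt i x y : nat_of x i < nat_of y i -> r i x < r i y.
  move=> xy; apply: (@leq_trans (nat_of x i * #|{: grid}| + #|{: grid}|)).
    by rewrite ltn_add2l.
  by rewrite -mulSnr (leq_trans _ (leq_addr _ _))// leq_mul2r xy orbT.
have [s [C [hC hs]]] := scarf (c \o nat_of) y0 r_inj I_gt1.
have {y0}[i1 i1C] : exists i, i \in C by have [i] := hs y0; exists i.
have [x0 x0s _] := hC _ i1C.
pose a i := [arg min_(x < x0 in s) nat_of x i].
have aP i : a i \in s /\ forall x, x \in s -> nat_of (a i) i <= nat_of x i.
  by rewrite /a; case: arg_minnP.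
pose mu i := if i \in C then nat_of (a i) i else 0.
have mule i x : x \in s -> mu i <= nat_of x i.
  by rewrite /mu; case: ifP => // iC; apply: (aP i).2.
have mule_sum : m < \sum_(i in C) (mu i).+1.
  rewrite ltnNge; apply/negP => le_m.
  (* The mass left over goes to the coordinate [i1], so that the total is [m]. *)
  pose g i := (if i \in C then (mu i).+1 else 0) +
    (if i == i1 then m - \sum_(i in C) (mu i).+1 else 0).
  have [y yg] : exists y : grid, forall i, val y i = g i :> nat.
    apply: grid_of; rewrite big_split /= -!big_mkcond big_pred1_eq.
    by rewrite subnKC.
  have [i iC /(_ (a i) (aP i).1)] := hs y; rewrite leqNgt rlt//.
  by rewrite [ltnRHS]ffunE yg /g iC /mu iC leq_addr.
have mule_sumT : m < \sum_i mu i + #|I|.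
  apply: leq_trans mule_sum _.
  rewrite (eq_bigr (fun i => mu i + 1)); last by move=> i _; rewrite addn1.
  rewrite big_split /= sum1_card leq_add ?max_card//.
  by rewrite [leqRHS](bigID (mem C))/= leq_addr.
(* [mu] is below [x] coordinatewise and the sums differ by less than [#|I|], so each coordinate does
   too. *)
have lemu i x : x \in s -> nat_of x i < mu i + #|I|.
  move=> xs; move: mule_sumT; rewrite -{1}(sumE x) (bigD1 i)//= [X in _ < X + _](bigD1 i)//=.
  have : \sum_(k | k != i) mu k <= \sum_(k | k != i) nat_of x k.
    by apply: leq_sum => k _; apply: mule.
  lia.
exists (nat_of x0); split; first exact: sumE.
(* Outside [C], [mu] is 0 and the coordinate would be below [#|I|]. *)
move=> j vj; have jC : j \in C.
  by have := lemu j _ x0s; rewrite /mu; case: ifP => // _; rewrite add0n ltnNge vj.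
have [x xs cx] := hC _ jC; exists (nat_of x); split=> // k.
by have := mule k _ xs; have := mule k _ x0s; have := lemu k _ xs; have := lemu k _ x0s; lia.
Qed.

End Grid.

From HB Require Import structures.
Require Import Defs.
From mathcomp Require Import all_order all_algebra lra finmap.
From mathcomp Require Import mathcomp_extra boolp classical_sets reals.
From mathcomp Require Import interval_inference topology normedtype derive exp complex.

Import Order.TTheory GRing.Theory Num.Theory.
Import numFieldNormedType.Exports.

Local Open Scope classical_set_scope.
Local Open Scope ring_scope.
Local Open Scope complex_scope.
Local Open Scope sesquilinear_scope.

Section Simplex.
Variables (R : realType) (N : nat).

Definition simplex : set 'rV[R]_N :=
  [set v | (forall i, 0 <= v 0 i) /\ \sum_i v 0 i = 1].

Lemma continuous_sum (T : topologicalType) (J : Type) (s : seq J) (P : pred J)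
    (f : J -> T -> R) :
  (forall j, continuous (f j)) -> continuous (fun t => \sum_(j <- s | P j) f j t).
Proof.
move=> fc; elim: s => [|j s IH].
  by under eq_fun do rewrite big_nil; move=> t; exact: cst_continuous.
under eq_fun do rewrite big_cons; case: (P j) => // t.
by apply: continuousD; [exact: fc | exact: IH].
Qed.

Lemma closed_ge_fun (T : topologicalType) (f : T -> R) (a : R) :
  continuous f -> closed [set t | a <= f t].
Proof.
by move=> fc; apply: (preimage_closed (f := f) (D := [set x | a <= x]));
  [move=> t _; exact: fc | exact: closed_ge]. Qed.

Lemma closed_eq_fun (T : topologicalType) (f : T -> R) (a : R) :
  continuous f -> closed [set t | f t = a].
Proof.
by move=> fc; apply: (preimage_closed (f := f) (D := [set x | x = a]));
  [move=> t _; exact: fc | exact: closed_eq]. Qed.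

Lemma closed_simplex : closed simplex.
Proof.
have -> : simplex = (\bigcap_i [set v : 'rV[R]_N | 0 <= v 0 i]) `&`
    [set v | \sum_i v 0 i = 1].
  by apply/seteqP; split => v /= [v0 v1]; split=> // i; [move=> _|]; exact: v0.
apply: closedI.
  by apply: closed_bigI => i _; apply: closed_ge_fun; exact: coord_continuous.
by apply/closed_eq_fun/continuous_sum => j; exact: coord_continuous.
Qed.

Lemma compact_simplex : compact simplex.
Proof.
apply: (@subclosed_compact _ _ [set v : 'rV[R]_N | forall i, `[0, 1]%classic (v ord0 i)]
  closed_simplex).
  by apply: (@rV_compact R _ (fun=> `[0, 1]%classic)) => _; exact: segment_compact.
move=> v [v0 v1] i /=; rewrite in_itv /= v0 -v1 (bigD1 i)//= lerDl.
by apply: sumr_ge0.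
Qed.

End Simplex.

(** Label each grid point of mesh [1 / m.+1] by a set containing it. [grid_labels] gives a point
    [w m] near which every label with a large enough coordinate occurs. At a cluster point [v], each
    [j] with [v_j > 0] is such a label for infinitely many [m], and closedness puts [v] in [L j]. *)
Theorem dual_kkm (R : realType) (N : nat) (L : 'I_N.+2 -> set 'rV[R]_N.+2) :
  (forall j, closed (L j)) ->
  (forall v, simplex v -> exists j, L j v) ->
  exists2 v, simplex v & forall j, v 0 j != 0 -> L j v.
Proof.
move=> Lcl Lcov; set K := N.+2.
pose pt m (f : {ffun 'I_K -> nat}) : 'rV[R]_K := \row_i ((f i)%:R / m.+1%:R).
have ptS m (f : {ffun 'I_K -> nat}) : (\sum_i f i = m.+1)%N -> simplex (pt m f).
  move=> sf; split=> [i|]; first by rewrite mxE divr_ge0.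
  under eq_bigr do rewrite mxE; by rewrite -mulr_suml -natr_sum sf divff// pnatr_eq0.
have /choice[c cP] : forall mf : nat * {ffun 'I_K -> nat}, exists j,
    (\sum_i mf.2 i = mf.1.+1)%N -> L j (pt mf.1 mf.2).
  move=> [m f] /=; have [sf|sf] := pselect (\sum_i f i = m.+1)%N.
    by have [j] := Lcov _ (ptS _ _ sf); exists j.
  by exists ord0.
have Kgt1 : (1 < #|'I_K|)%N by rewrite card_ord.
have /choice[u uP] := fun m => grid_labels m.+1 Kgt1 (fun f => c (m, f)).
pose w m := pt m (u m).
have [] := @compact_simplex R K (w @ \oo).
  by exists 0%N => // m _; apply: ptS; exact: (uP m).1.
move=> v [vS vcl]; exists v => // j vj.
have {}vj : 0 < v 0 j by rewrite lt_neqAle eq_sym vj vS.1.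
apply: Lcl => B /nbhs_ballP[e e0 eB].
(* [e / 2] bounds each of the two moves, from [v] to [w m] and on to the labelled point; [v_j / 2]
   keeps coordinate [j] of [w m] above [K / m.+1], the threshold of [grid_labels]. *)
pose d := Num.min (e / 2) (v 0 j / 2).
have d0 : 0 < d by rewrite lt_min !divr_gt0.
have [M _ hM] := near_infty_natSinv_lt (PosNum (divr_gt0 d0 (ltr0Sn R N.+1))).
have {}hM m : (M <= m)%N -> K%:R / m.+1%:R < d.
  by move=> /hM /=; rewrite ltr_pdivlMr// mulrC.
have [_ [[m Mm <-] wB]] : [set w m | m in [set m | (M <= m)%N]] `&` ball v d !=set0.
  apply: vcl; last exact: nbhsx_ballx.
  by exists M => // m Mm; exists m.
have {}wB k : `|v 0 k - w m 0 k| < d by have := wB.2 0 k.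
have [su hu] := uP m.
have Ku : (#|'I_K| <= u m j)%N.
  rewrite card_ord -(ler_nat R) -(ler_pM2r (x := m.+1%:R^-1)) ?invr_gt0//.
  apply/ltW/(lt_le_trans (hM _ Mm)).
  have := wB j; rewrite [w m 0 j]mxE ltr_distlC => /andP[h _].
  have half (a b : R) : d <= a / 2 -> a - d < b -> d <= b by lra.
  by apply: (half (v 0 j)); rewrite // ge_min lexx orbT.
have [x [sx cx xu]] := hu _ Ku.
exists (pt m x); split; first by rewrite -cx; exact: (cP (m, x)).
apply: eB; split=> // i k; rewrite (ord1 i) /ball /=.
rewrite -(subrKA (w m 0 k)); apply: le_lt_trans (ler_normD _ _) _.
have wx : `|w m 0 k - pt m x 0 k| <= K%:R / m.+1%:R.
  rewrite !mxE -mulrBl normrM [X in _ * X]gtr0_norm ?invr_gt0//.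
  rewrite ler_pM2r ?invr_gt0// ler_distl lerBlDr -!natrD !ler_nat.
  by have [] := xu k; rewrite card_ord => -> ->.
have de : d <= e / 2 by rewrite ge_min lexx.
rewrite (splitr e) ltrD// ?(lt_le_trans (wB k))//.
exact: le_lt_trans wx (lt_le_trans (hM _ Mm) de).
Qed.

(** * Positive semidefinite matrices *)

Section Spectral.
Variables (R : realType) (n : nat).
Local Notation C := R[i].
Implicit Types (A G U : 'M[C]_n) (d : 'rV[R]_n) (x y : 'cV[C]_n).

Lemma trmxC_mul m k l (A : 'M[C]_(m, k)) (B : 'M[C]_(k, l)) :
  (A *m B)^t* = B^t* *m A^t*.
Proof. by rewrite trmx_mul map_mxM. Qed.

Lemma hermsymmxP A : reflect (A^t* = A) (A \is hermsymmx).
Proof.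
apply: (iffP (is_hermitianmxP _ _ _)); rewrite expr0 scale1r => E //.
Qed.

Lemma conjC_real_complex (a : R) : Num.conj a%:C = a%:C.
Proof. by apply: conj_Creal; rewrite complex_real. Qed.

Definition qform A x : C := (x^t* *m A *m x) 0 0.

Definition psdmx A := A^t* = A /\ forall x, 0 <= qform A x.

Definition spmx U d : 'M[C]_n :=
  U *m diag_mx (map_mx (real_complex R) d) *m U^t*.

Lemma spmx_herm U d : (spmx U d)^t* = spmx U d.
Proof.
rewrite /spmx !trmxC_mul trmxCK mulmxA tr_diag_mx map_diag_mx.
suff -> : map_mx Num.conj (map_mx (real_complex R) d) = map_mx (real_complex R) d by [].
by apply/rowP => i; rewrite !mxE; exact: conjC_real_complex.
Qed.

Lemma qform_conj G U x : qform (U *m G *m U^t*) x = qform G (U^t* *m x).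
Proof. by rewrite /qform trmxC_mul trmxCK !mulmxA. Qed.

Lemma qform_spmx U d x :
  qform (spmx U d) x = \sum_i (d 0 i)%:C * `|(U^t* *m x) i 0| ^+ 2.
Proof.
rewrite qform_conj /qform mul_mx_diag mxE; move: (U^t* *m x) => y.
by apply: eq_bigr => i _; rewrite !mxE normCK -mulrA mulrC -mulrA.
Qed.

Lemma spmx_psd U d : (forall i, 0 <= d 0 i) -> psdmx (spmx U d).
Proof.
move=> d0; split=> [|x]; first exact: spmx_herm.
rewrite qform_spmx; apply: sumr_ge0 => i _.
by rewrite mulr_ge0 ?exprn_ge0 ?normr_ge0// ler0c.
Qed.

Lemma qform_col G U i : qform G (col i U) = (U^t* *m G *m U) i i.
Proof.
rewrite colE /qform trmxC_mul [in LHS]trmx_delta map_delta_mx.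
transitivity ((delta_mx (0 : 'I_1) i *m (U^t* *m G *m U) *m delta_mx i (0 : 'I_1)) 0 0).
  by rewrite !mulmxA.
by rewrite -rowE -colE !mxE.
Qed.

Lemma mxtrace_mul_spmx G U d :
  \tr (G *m spmx U d) = \sum_i (d 0 i)%:C * qform G (col i U).
Proof.
rewrite /spmx mulmxA mxtrace_mulC !mulmxA mul_mx_diag.
by apply: eq_bigr => i _; rewrite qform_col mxE mulrC mxE.
Qed.

Lemma unitarymx_mulCV U : U \is unitarymx -> U^t* *m U = 1%:M.
Proof. by move=> /unitarymxP/mulmx1C. Qed.

Lemma mxtrace_spmx U d : U \is unitarymx -> \tr (spmx U d) = (\sum_i d 0 i)%:C.
Proof.
move=> Uu; rewrite /spmx mxtrace_mulC mulmxA unitarymx_mulCV// mul1mx mxtrace_diag.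
by rewrite rmorph_sum; apply: eq_bigr => i _; rewrite mxE.
Qed.

Lemma qform_spmx_col U d i : U \is unitarymx -> qform (spmx U d) (col i U) = (d 0 i)%:C.
Proof.
move=> Uu; rewrite qform_col /spmx !mulmxA unitarymx_mulCV// mul1mx.
by rewrite -mulmxA unitarymx_mulCV// mulmx1 !mxE eqxx.
Qed.

Lemma herm_spmx A : A^t* = A -> exists U d, U \is unitarymx /\ A = spmx U d.
Proof.
move=> /hermsymmxP Ah; have Vu := spectral_unitarymx A.
exists ((spectralmx A)^t*), (map_mx (@complex.Re R) (spectral_diag A)).
split; first by rewrite trmxC_unitary.
have := orthomx_spectralP (hermitian_normalmx Ah).
rewrite invmx_unitary// /spmx trmxCK => {1}->; congr (_ *m diag_mx _ *m _).
apply/rowP => i; rewrite !mxE RRe_real//.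
by have /mxOverP := hermitian_spectral_diag_real Ah; apply.
Qed.

Lemma psd_spmx A : psdmx A ->
  exists U d, [/\ U \is unitarymx, forall i, 0 <= d 0 i & A = spmx U d].
Proof.
move=> [Ah A0]; have [U [d [Uu AE]]] := herm_spmx Ah; exists U, d; split=> // i.
by have := A0 (col i U); rewrite AE qform_spmx_col// ler0c.
Qed.

Lemma unitarymx_col_neq0 U i : U \is unitarymx -> col i U != 0.
Proof.
move=> Uu; apply/eqP => /(congr1 (mulmx (U^t*))).
rewrite mulmx0 colE mulmxA unitarymx_mulCV// mul1mx => /matrixP/(_ i 0).
by rewrite !mxE !eqxx => /eqP; rewrite oner_eq0.
Qed.

Lemma posdefmxP A : posdefmx A <-> A^t* = A /\ forall x, x != 0 -> 0 < qform A x.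
Proof. by split=> -[/hermsymmxP]. Qed.

Lemma posdef_spmx A : posdefmx A ->
  exists U d, [/\ U \is unitarymx, forall i, 0 < d 0 i & A = spmx U d].
Proof.
move=> /posdefmxP[Ah A0]; have [U [d [Uu AE]]] := herm_spmx Ah; exists U, d.
split=> // i; have := A0 _ (unitarymx_col_neq0 i Uu).
by rewrite AE qform_spmx_col// ltcR.
Qed.

Lemma spmx_powR U d p : U \is unitarymx ->
  mxpowR (spmx U d) p = spmx U (map_mx (@powR R ^~ p) d).
Proof.
move=> Uu; rewrite (mxpowR_unitary _ _ Uu) /diag_powR /spmx.
suff -> : map_mx (fun z : C => (complex.Re z `^ p)%:C) (map_mx (real_complex R) d) =
  map_mx (real_complex R) (map_mx (@powR R ^~ p) d) by [].
by apply/rowP => i; rewrite !mxE.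
Qed.

(** For fixed [U] the kernel depends only on which eigenvalues vanish; this is how positive powers
    come to share it. *)
Lemma spmx_mul_eq0 U d y : U \is unitarymx ->
  spmx U d *m y = 0 <-> forall i, d 0 i = 0 \/ (U^t* *m y) i 0 = 0.
Proof.
move=> Uu; split=> [h i|h].
  have : diag_mx (map_mx (real_complex R) d) *m (U^t* *m y) = 0.
    have := congr1 (mulmx (U^t*)) h.
    by rewrite /spmx !mulmxA unitarymx_mulCV// mul1mx mulmx0.
  move=> /matrixP/(_ i 0); rewrite mul_diag_mx mxE [X in _ = X]mxE mxE.
  by move/eqP; rewrite mulf_eq0 => /orP[/eqP[]|/eqP]; [left|right].
rewrite /spmx -!mulmxA -[RHS](mulmx0 _ U); congr (_ *m _).
apply/matrixP => i j; rewrite ord1 mul_diag_mx mxE [X in _ = X]mxE mxE.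
by case: (h i) => ->; rewrite ?mul0r ?mulr0.
Qed.

(** A sum of terms [d_i |u_i^* y|^2 >= 0] vanishes only termwise, so the form is zero only on the
    kernel. *)
Lemma qform_spmx_gt0 U d y : U \is unitarymx -> (forall i, 0 <= d 0 i) ->
  spmx U d *m y != 0 -> 0 < qform (spmx U d) y.
Proof.
move=> Uu d0; apply: contraNT => h; apply/eqP/spmx_mul_eq0 => // i.
have t0 j : 0 <= (d 0 j)%:C * `|(U^t* *m y) j 0| ^+ 2.
  by rewrite mulr_ge0 ?exprn_ge0 ?normr_ge0// ler0c.
have : qform (spmx U d) y == 0.
  by apply: contraNT h => h; rewrite lt_neqAle eq_sym h (spmx_psd U d0).2.
rewrite qform_spmx psumr_eq0 // => /allP/(_ i (mem_index_enum _)) /=.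
rewrite mulf_eq0 expf_eq0 normr_eq0 /= => /orP[/eqP[]|/eqP]; by [left|right].
Qed.

Lemma spmx_posdef U d : U \is unitarymx -> (forall i, 0 < d 0 i) ->
  posdefmx (spmx U d).
Proof.
move=> Uu d0; apply/posdefmxP; split=> [|x x0]; first exact: spmx_herm.
apply: qform_spmx_gt0 => // [i|]; first exact: ltW.
apply: contra_neq x0 => /(spmx_mul_eq0 _ _ Uu) h.
have : U^t* *m x = 0.
  apply/matrixP => i j; rewrite ord1 [RHS]mxE.
  by case: (h i) => // di; have := d0 i; rewrite di ltxx.
move=> /(congr1 (mulmx U)); rewrite mulmxA; have /unitarymxP -> := Uu.
by rewrite mul1mx mulmx0.
Qed.

Lemma posdef_powR A p : posdefmx A -> posdefmx (mxpowR A p).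
Proof.
move=> /posdef_spmx[U [d [Uu d0 ->]]]; rewrite (spmx_powR _ _ Uu).
by apply: (spmx_posdef Uu) => i; rewrite mxE powR_gt0.
Qed.

Lemma qformD A B x : qform (A + B) x = qform A x + qform B x.
Proof. by rewrite /qform mulmxDr mulmxDl mxE. Qed.

Lemma qformZ a A x : qform (a *: A) x = a * qform A x.
Proof. by rewrite /qform -scalemxAr -scalemxAl mxE. Qed.

Lemma psd0 : psdmx 0.
Proof.
split; first by apply/matrixP => i j; rewrite !mxE conjC0.
by move=> x; rewrite /qform mulmx0 mul0mx mxE.
Qed.

Lemma psdD A B : psdmx A -> psdmx B -> psdmx (A + B).
Proof.
move=> [Ah A0] [Bh B0]; split; first by rewrite linearD /= map_mxD Ah Bh.
by move=> x; rewrite qformD addr_ge0.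
Qed.

Lemma psdZ (a : R) A : 0 <= a -> psdmx A -> psdmx (a%:C *: A).
Proof.
move=> a0 [Ah A0]; split; last by move=> x; rewrite qformZ mulr_ge0 ?ler0c.
rewrite linearZ /= map_mxZ Ah; congr (_ *: _).
exact: conjC_real_complex.
Qed.

Lemma psd_sum (I : Type) (s : seq I) (F : I -> 'M[C]_n) :
  (forall i, psdmx (F i)) -> psdmx (\sum_(i <- s) F i).
Proof.
by move=> F0; elim/big_ind: _ => [|A B|i _]; [exact: psd0 | exact: psdD | exact: F0].
Qed.

Lemma psd_rank1 y : psdmx (y *m y^t*).
Proof.
split=> [|x]; first by rewrite trmxC_mul trmxCK.
have -> : qform (y *m y^t*) x = `|(y^t* *m x) 0 0| ^+ 2.
  rewrite /qform !mulmxA -mulmxA mxE big_ord1 normCK mulrC; congr (_ * _).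
  have -> : x^t* *m y = (y^t* *m x)^t* by rewrite trmxC_mul trmxCK.
  by rewrite !mxE.
by rewrite exprn_ge0.
Qed.

Lemma mxtrace_rank1 G y : \tr (G *m (y *m y^t*)) = qform G y.
Proof. by rewrite mulmxA mxtrace_mulC mulmxA /mxtrace big_ord1. Qed.

(* If [G = sum_i e_i w_i w_i^*], then [tr (G A) = sum_i e_i (w_i^* A w_i)]. *)
Lemma psd_orth_posdef G A : psdmx G -> posdefmx A ->
  complex.Re (\tr (G *m A)) <= 0 -> G = 0.
Proof.
move=> /psd_spmx[W [e [Wu e0 ->]]] /posdefmxP[_ A0].
rewrite mxtrace_mulC mxtrace_mul_spmx raddf_sum /= => h.
have q0 i : 0 < complex.Re (qform A (col i W)).
  by have := A0 _ (unitarymx_col_neq0 i Wu); rewrite ltcE => /andP[_].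
have tE i : complex.Re ((e 0 i)%:C * qform A (col i W)) =
    e 0 i * complex.Re (qform A (col i W)).
  by case: (qform _ _) => a b /=; rewrite mul0r subr0.
have t0 i : 0 <= complex.Re ((e 0 i)%:C * qform A (col i W)).
  by rewrite tE mulr_ge0// ltW.
suff -> : e = 0.
  by rewrite /spmx map_mx0 raddf0 mulmx0 mul0mx.
apply/rowP => i; rewrite mxE; apply/eqP.
have /eqP : \sum_i complex.Re ((e 0 i)%:C * qform A (col i W)) = 0.
  by apply/eqP; rewrite eq_le h sumr_ge0.
rewrite psumr_eq0// => /allP/(_ i (mem_index_enum _)) /=.
by rewrite tE mulf_eq0 [X in _ || X]gt_eqF ?orbF.
Qed.

End Spectral.

(** * Symmetric words *)

(** Indexing letters by [nat] makes the removal of outer letters a shift; only indices up to [k] for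
    [P] and below [k] for [Q] matter. *)
Definition palindrome (T1 T2 : Type) k (P : nat -> T1) (Q : nat -> T2) :=
  (forall i, (i <= k)%N -> P (k - i)%N = P i) /\
  (forall i, (i < k)%N -> Q (k.-1 - i)%N = Q i).

Lemma palindrome_peel (T1 T2 : Type) k (P : nat -> T1) (Q : nat -> T2) :
  palindrome k.+2 P Q ->
  [/\ P k.+2 = P 0%N, Q k.+1 = Q 0%N & palindrome k (P \o S) (Q \o S)].
Proof.
move=> [hP hQ]; split; [by rewrite -(hP 0%N) ?subn0 | by rewrite -(hQ 0%N) ?subn0 | split].
- by move=> i ik /=; rewrite -(hP i.+1) 1?ltnW//; congr (P _); lia.
- by move=> i ik /=; rewrite -(hQ i.+1); [congr (Q _); lia | lia].
Qed.

Section Word.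
Variables (R : realType) (n : nat).
Local Notation C := R[i].
Implicit Types (P Q : nat -> 'M[C]_n).

Definition word k P Q : 'M[C]_n := (\prod_(i < k) (P i *m Q i)) *m P k.

Lemma eq_word k P Q P' Q' : (forall i, (i <= k)%N -> P i = P' i) ->
  (forall i, (i < k)%N -> Q i = Q' i) -> word k P Q = word k P' Q'.
Proof.
move=> PE QE; rewrite /word PE//; congr (_ *m _); apply: eq_bigr => i _.
by rewrite PE ?QE// ltnW.
Qed.

Lemma word_peel k P Q : word k.+2 P Q =
  P 0%N *m Q 0%N *m word k (P \o S) (Q \o S) *m Q k.+1 *m P k.+2.
Proof.
rewrite /word big_ord_recl big_ord_recr /= -[in LHS]mulmxE !mulmxA.
by congr (_ *m _ *m _ *m _ *m _ *m _); apply: eq_bigr => i _.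
Qed.

Lemma word_scale k P Q (a : nat -> R) :
  word k (fun i => (a i)%:C *: P i) Q =
  (\prod_(i < k.+1) a i)%:C *: word k P Q.
Proof.
rewrite /word big_ord_recr /= rmorphM /= mulrC -scalemxAr -scalerA; congr (_ *: _).
rewrite scalemxAl; congr (_ *m _); elim: k => [|k IH].
  by rewrite !big_ord0 rmorph1 scale1r.
by rewrite !big_ord_recr /= IH rmorphM /= -!mulmxE -!scalemxAl -!scalemxAr scalerA.
Qed.

(** Induction in steps of two: peeling the outer letters on both sides leaves a palindromic word. *)
Lemma word_herm k P Q : (forall i, (P i)^t* = P i) -> (forall i, (Q i)^t* = Q i) ->
  palindrome k P Q -> (word k P Q)^t* = word k P Q.
Proof.
elim/ltn_ind: k P Q => -[|[|k]] IH P Q Ph Qh pal.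
- by rewrite /word big_ord0 mul1mx.
- rewrite /word big_ord_recl big_ord0 mulr1 !trmxC_mul !Ph Qh.
  by have := pal.1 0%N isT; rewrite subn0 => ->; rewrite mulmxA.
- have [PE QE pal'] := palindrome_peel pal; rewrite word_peel PE QE.
  have := IH k (ltnW (ltnSn _)) (P \o S) (Q \o S) (fun=> Ph _) (fun=> Qh _) pal'.
  by move: (word k _ _) => w wh; rewrite !trmxC_mul !Ph !Qh wh !mulmxA.
Qed.

(* In the induction the two outer letters are absorbed into the vector, and
   [B^q A^p y] stays outside the kernel of [A] whenever [y] does. *)
Lemma word_qform_gt0 (A : 'M[C]_n) k P Q :
  (forall i, (P i)^t* = P i) -> (forall i, posdefmx (Q i)) ->
  (forall i (y : 'cV_n), A *m y = 0 -> P i *m y = 0) ->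
  (forall i (y : 'cV_n), A *m y != 0 -> 0 < qform (P i) y) ->
  palindrome k P Q ->
  forall y : 'cV_n, A *m y != 0 -> 0 < qform (word k P Q) y.
Proof.
elim/ltn_ind: k P Q => -[|[|k]] IH P Q Ph Qp Pk Pp pal y yA.
- by rewrite /word big_ord0 mul1mx; exact: Pp.
all: have Py0 i : P i *m y != 0.
- apply: contraTneq (Pp i _ yA) => Py.
  by rewrite /qform -mulmxA Py mulmx0 mxE ltxx.
- rewrite /word big_ord_recl big_ord0 mulr1.
  have := pal.1 0%N isT; rewrite subn0 => ->.
  have := (posdefmxP (Q 0%N)).1 (Qp _) => -[_ /(_ _ (Py0 0%N))].
  by rewrite /qform trmxC_mul Ph !mulmxA.
- apply: contraTneq (Pp i _ yA) => Py.
  by rewrite /qform -mulmxA Py mulmx0 mxE ltxx.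
have [PE QE pal'] := palindrome_peel pal; rewrite word_peel PE QE.
have [Qh Q0] := (posdefmxP (Q 0%N)).1 (Qp _).
have -> w : qform (P 0%N *m Q 0%N *m w *m Q 0%N *m P 0%N) y =
    qform w (Q 0%N *m (P 0%N *m y)).
  by rewrite /qform !trmxC_mul Ph Qh !mulmxA.
apply: IH pal' _ _; first exact: ltnW; [move=> i; exact: Ph|move=> i; exact: Qp|
  move=> i; exact: Pk|move=> i; exact: Pp|].
apply: contraTneq (Q0 _ (Py0 0%N)) => /(Pk 0%N) h.
by rewrite /qform trmxC_mul Ph -!mulmxA h mulmx0 mxE ltxx.
Qed.

End Word.

(** * Continuity of spectral expressions *)

(** The absolute value gives a function continuous on the whole line. Continuity at 0 matters
    because semidefinite matrices may have eigenvalue 0. *)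
Lemma continuous_norm_powR (R : realType) (p : R) : 0 < p ->
  continuous (fun x : R => `|x| `^ p).
Proof.
move=> p0 x; have [->|x0] := eqVneq x 0.
  rewrite /continuous_at normr0 powR0 ?gt_eqF//.
  apply/cvgrPdist_lt => e e0; apply/nbhs_ballP; exists (e `^ p^-1) => /=.
    exact: powR_gt0.
  move=> y; rewrite /ball /= !sub0r !normrN => ye.
  have -> : e = (e `^ p^-1) `^ p by rewrite -powRrM mulVf ?gt_eqF// powRr1// ltW.
  by rewrite ger0_norm ?powR_ge0// gt0_ltr_powR// ?nnegrE ?powR_ge0.
have nx0 : 0 < `|x| by rewrite normr_gt0.
apply: (@continuous_comp _ _ _ (Num.norm : R -> R) (@powR R ^~ p)).
  exact: norm_continuous.
apply/differentiable_continuous/derivable1_diffP.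
by have [] := is_derive1_powR p nx0.
Qed.

(** * Continuity of complex and matrix-valued maps *)

Section ComplexContinuity.
Variables (R : realType) (X : topologicalType).
Local Notation C := R[i].

(** Phrased through real and imaginary parts, so that all limits are taken in [R]. *)
Definition ccontinuous (g : X -> C) :=
  continuous (fun x => complex.Re (g x)) /\ continuous (fun x => complex.Im (g x)).

Lemma ccontinuous_cst c : ccontinuous (fun=> c).
Proof. by split=> x; exact: cst_continuous. Qed.

Lemma ccontinuousD f g : ccontinuous f -> ccontinuous g ->
  ccontinuous (fun x => f x + g x).
Proof.
move=> [f1 f2] [g1 g2]; split=> x.
  by under eq_fun do rewrite raddfD; apply: continuousD; [exact: f1 | exact: g1].
by under eq_fun do rewrite raddfD; apply: continuousD; [exact: f2 | exact: g2].
Qed.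

Lemma ccontinuousM f g : ccontinuous f -> ccontinuous g ->
  ccontinuous (fun x => f x * g x).
Proof.
move=> [f1 f2] [g1 g2]; split=> x.
  have -> : (fun x => complex.Re (f x * g x)) = (fun x =>
      complex.Re (f x) * complex.Re (g x) - complex.Im (f x) * complex.Im (g x)).
    by apply/funext => z; case: (f z) (g z) => a b [].
  apply: cvgB; apply: cvgM;
    by [exact: f1|exact: f2|exact: g1|exact: g2].
have -> : (fun x => complex.Im (f x * g x)) = (fun x =>
    complex.Re (f x) * complex.Im (g x) + complex.Im (f x) * complex.Re (g x)).
  by apply/funext => z; case: (f z) (g z) => a b [].
apply: cvgD; apply: cvgM;
  by [exact: f1|exact: f2|exact: g1|exact: g2].
Qed.

Lemma ccontinuous_conj f : ccontinuous f -> ccontinuous (fun x => Num.conj (f x)).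
Proof.
move=> [f1 f2]; split=> x.
  have -> : (fun x => complex.Re (Num.conj (f x))) = (fun x => complex.Re (f x)).
    by apply/funext => z; case: (f z).
  exact: f1.
have -> : (fun x => complex.Im (Num.conj (f x))) = (fun x => - complex.Im (f x)).
  by apply/funext => z; case: (f z).
apply: continuousN; exact: f2.
Qed.

Lemma ccontinuous_real (f : X -> R) : continuous f -> ccontinuous (fun x => (f x)%:C).
Proof. by move=> fc; split=> x /=; [exact: fc | exact: cst_continuous]. Qed.

Lemma ccontinuous_sum (J : Type) (s : seq J) (P : pred J) (f : J -> X -> C) :
  (forall j, ccontinuous (f j)) -> ccontinuous (fun x => \sum_(j <- s | P j) f j x).
Proof.
move=> fc; elim: s => [|j s IH].
  by under eq_fun do rewrite big_nil; exact: ccontinuous_cst.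
under eq_fun do rewrite big_cons; case: (P j) => //.
exact: ccontinuousD.
Qed.

Definition mxcontinuous m k (f : X -> 'M[C]_(m, k)) :=
  forall i j, ccontinuous (fun x => f x i j).

Lemma mxcontinuous_cst m k (A : 'M[C]_(m, k)) : mxcontinuous (fun=> A).
Proof. by move=> i j; exact: ccontinuous_cst. Qed.

Lemma mxcontinuousD m k (f g : X -> 'M[C]_(m, k)) :
  mxcontinuous f -> mxcontinuous g -> mxcontinuous (fun x => f x + g x).
Proof.
by move=> fc gc i j; under eq_fun do rewrite mxE; exact: ccontinuousD.
Qed.

Lemma mxcontinuousZ m k (a : X -> C) (f : X -> 'M[C]_(m, k)) :
  ccontinuous a -> mxcontinuous f -> mxcontinuous (fun x => a x *: f x).
Proof.
by move=> ac fc i j; under eq_fun do rewrite mxE; exact: ccontinuousM.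
Qed.

Lemma mxcontinuousB m k (f g : X -> 'M[C]_(m, k)) :
  mxcontinuous f -> mxcontinuous g -> mxcontinuous (fun x => f x - g x).
Proof.
move=> fc gc; under eq_fun do rewrite -scaleN1r.
by apply/mxcontinuousD/mxcontinuousZ => //; exact: ccontinuous_cst.
Qed.

Lemma mxcontinuous_sum m k (J : Type) (s : seq J) (f : J -> X -> 'M[C]_(m, k)) :
  (forall j, mxcontinuous (f j)) -> mxcontinuous (fun x => \sum_(j <- s) f j x).
Proof.
move=> fc i j; under eq_fun do rewrite summxE.
by apply: ccontinuous_sum => l; exact: fc.
Qed.

Lemma mxcontinuousM m k l (f : X -> 'M[C]_(m, k)) (g : X -> 'M[C]_(k, l)) :
  mxcontinuous f -> mxcontinuous g -> mxcontinuous (fun x => f x *m g x).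
Proof.
move=> fc gc i j; under eq_fun do rewrite mxE.
by apply: ccontinuous_sum => h; exact: ccontinuousM.
Qed.

Lemma mxcontinuous_adj m k (f : X -> 'M[C]_(m, k)) :
  mxcontinuous f -> mxcontinuous (fun x => (f x)^t*).
Proof.
by move=> fc i j; under eq_fun do rewrite !mxE; exact: ccontinuous_conj.
Qed.

Lemma mxcontinuous_spmx n (U : X -> 'M[C]_n) (d : X -> 'rV[R]_n) :
  mxcontinuous U -> (forall i, continuous (fun x => d x 0 i)) ->
  mxcontinuous (fun x => spmx (U x) (d x)).
Proof.
move=> Uc dc; apply: mxcontinuousM; last exact: mxcontinuous_adj.
apply: mxcontinuousM => // i j; under eq_fun do rewrite !mxE.
by case: (i == j) => /=; [apply: ccontinuous_real|exact: ccontinuous_cst].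
Qed.

Lemma mxcontinuous_word n k (P : X -> nat -> 'M[C]_n) (Q : nat -> 'M[C]_n) :
  (forall i, mxcontinuous (fun x => P x i)) ->
  mxcontinuous (fun x => word k (P x) Q).
Proof.
move=> Pc; apply: mxcontinuousM => //; elim: k => [|k IH].
  by under eq_fun do rewrite big_ord0; exact: mxcontinuous_cst.
under eq_fun do rewrite big_ord_recr /= -mulmxE.
apply: mxcontinuousM => //; apply: mxcontinuousM => //; exact: mxcontinuous_cst.
Qed.

Lemma continuous_Re_mxtrace n (f : X -> 'M[C]_n) :
  mxcontinuous f -> continuous (fun x => complex.Re (\tr (f x))).
Proof.
by move=> fc; apply: (ccontinuous_sum _ _ (fun i => fc i i)).1.
Qed.

Lemma closed_mxcontinuous_eq m k (f : X -> 'M[C]_(m, k)) (A : 'M[C]_(m, k)) :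
  mxcontinuous f -> closed [set x | f x = A].
Proof.
move=> fc; have -> : [set x | f x = A] = \bigcap_i \bigcap_j
    ([set x | complex.Re (f x i j) = complex.Re (A i j)] `&`
     [set x | complex.Im (f x i j) = complex.Im (A i j)]).
  apply/seteqP; split => x /=; first by move=> fx i _ j _; rewrite /= fx.
  move=> h; apply/matrixP => i j; apply/eqP; rewrite eq_complex.
  by have [/= -> ->] := h i I j I; rewrite !eqxx.
apply: closed_bigI => i _; apply: closed_bigI => j _.
by apply: closedI; apply: closed_eq_fun; have [] := fc i j.
Qed.

End ComplexContinuity.

(** * The variational inequality *)

(* Real coordinates for pairs of a basis and a spectrum. *)
Local Notation spcoord R n := ('rV[R]_(n * n) * 'rV[R]_(n * n) * 'rV[R]_n)%type.

(** * Compact coordinates for positive semidefinite matrices of bounded trace *)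

Section Spectrahedron.
Variables (R : realType) (n : nat).
Local Notation C := R[i].

Definition sp_basis (t : spcoord R n) : 'M[C]_n :=
  \matrix_(i, j) Complex (t.1.1 0 (mxvec_index i j)) (t.1.2 0 (mxvec_index i j)).

Definition sp_mx (t : spcoord R n) : 'M[C]_n := spmx (sp_basis t) t.2.

(** In these coordinates powers act explicitly on the spectrum, so compactness and continuity are
    treated here rather than on matrices. One matrix may have many coordinates. *)
Definition spcoord_le (M : R) : set (spcoord R n) :=
  [set t | [/\ sp_basis t *m (sp_basis t)^t* = 1%:M,
               forall i, 0 <= t.2 0 i & \sum_i t.2 0 i <= M]].

Lemma continuous_spectrum i : continuous (fun t : spcoord R n => t.2 0 i).
Proof.
move=> t; apply: (@continuous_comp _ _ _ snd (fun v : 'rV[R]_n => v 0 i)).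
  exact: cvg_snd.
exact: coord_continuous.
Qed.

Lemma mxcontinuous_sp_basis : mxcontinuous sp_basis.
Proof.
move=> i j; split; under eq_fun do rewrite mxE /=.
  move=> t; apply: (@continuous_comp _ _ _ fst
    (fun v : 'rV[R]_(n * n) * 'rV[R]_(n * n) => v.1 0 (mxvec_index i j))).
    exact: cvg_fst.
  apply: (@continuous_comp _ _ _ fst (fun v : 'rV[R]_(n * n) => v 0 (mxvec_index i j))).
    exact: cvg_fst.
  exact: coord_continuous.
move=> t; apply: (@continuous_comp _ _ _ fst
    (fun v : 'rV[R]_(n * n) * 'rV[R]_(n * n) => v.2 0 (mxvec_index i j))).
  exact: cvg_fst.
apply: (@continuous_comp _ _ _ snd (fun v : 'rV[R]_(n * n) => v 0 (mxvec_index i j))).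
  exact: cvg_snd.
exact: coord_continuous.
Qed.

Lemma mxcontinuous_sp_mx : mxcontinuous sp_mx.
Proof. exact/mxcontinuous_spmx/continuous_spectrum/mxcontinuous_sp_basis. Qed.

(** Each row of a unitary matrix has norm 1. *)
Lemma unitarymx_entry (U : 'M[C]_n) i j : U \is unitarymx ->
  `|complex.Re (U i j)| <= 1 /\ `|complex.Im (U i j)| <= 1.
Proof.
move=> /unitarymxP/matrixP/(_ i i); rewrite !mxE eqxx => E.
have E2 : \sum_k (complex.Re (U i k) ^+ 2 + complex.Im (U i k) ^+ 2) = 1.
  apply: (@complexI R); rewrite rmorph_sum -[RHS]E; apply: eq_bigr => k _.
  by rewrite !mxE -normCK -add_Re2_Im2.
have le1 : complex.Re (U i j) ^+ 2 + complex.Im (U i j) ^+ 2 <= 1.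
  rewrite -E2 (bigD1 j)//= lerDl; apply: sumr_ge0 => k _.
  by rewrite addr_ge0 ?sqr_ge0.
split; rewrite -(@ler_pXn2r _ 2)// ?nnegrE// expr1n real_normK ?num_real//;
  apply: le_trans le1; by rewrite ?lerDl ?lerDr sqr_ge0.
Qed.

Lemma closed_spcoord_le M : closed (spcoord_le M).
Proof.
have -> : spcoord_le M =
    [set t | sp_basis t *m (sp_basis t)^t* = 1%:M] `&`
    ((\bigcap_i [set t : spcoord R n | 0 <= t.2 0 i]) `&`
     [set t : spcoord R n | - M <= - (\sum_i t.2 0 i)]).
  apply/seteqP; split=> t /=.
    by move=> [tu t0 tM]; split=> //; split; [move=> i _; exact: t0|rewrite lerN2].
  move=> [tu [t0]]; rewrite lerN2 => tM; split=> // i; exact: t0.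
apply: closedI.
  apply: closed_mxcontinuous_eq; apply: mxcontinuousM; first exact: mxcontinuous_sp_basis.
  exact/mxcontinuous_adj/mxcontinuous_sp_basis.
apply: closedI.
  by apply: closed_bigI => i _; apply/closed_ge_fun/continuous_spectrum.
apply: closed_ge_fun => t; apply: continuousN.
exact: (continuous_sum continuous_spectrum).
Qed.

Lemma compact_spcoord_le M : compact (spcoord_le M).
Proof.
pose box k (a : R) := [set v : 'rV[R]_k | forall i, `[- a, a]%classic (v ord0 i)].
have cbox k a : compact (box k a).
  by apply: (@rV_compact R k (fun=> `[- a, a]%classic)) => _; exact: segment_compact.
apply: (@subclosed_compact _ _ (box (n * n)%N 1 `*` box (n * n)%N 1 `*` box n M)
  (@closed_spcoord_le M)).
  by apply: compact_setX; [apply: compact_setX|]; exact: cbox.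
move=> t [/unitarymxP tu t0 tM]; split; [split|] => i /=; rewrite in_itv /= -ler_norml.
- case/mxvec_indexP: i => i j.
  by have [+ _] := unitarymx_entry i j tu; rewrite mxE.
- case/mxvec_indexP: i => i j.
  by have [_ +] := unitarymx_entry i j tu; rewrite mxE.
- rewrite ger0_norm//; apply: le_trans tM.
  by rewrite (bigD1 i)//= lerDl sumr_ge0.
Qed.

Definition spectrahedron M (A : 'M[C]_n) := psdmx A /\ complex.Re (\tr A) <= M.

Lemma spcoord_of (U : 'M[C]_n) (d : 'rV[R]_n) :
  exists t : spcoord R n, sp_basis t = U /\ t.2 = d.
Proof.
exists (mxvec (map_mx (@complex.Re R) U), mxvec (map_mx (@complex.Im R) U), d); split=> //.
by apply/matrixP => i j; rewrite !mxE /= !mxvecE !mxE; case: (U i j).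
Qed.

Lemma spectrahedronP M A :
  spectrahedron M A <-> exists2 t, spcoord_le M t & A = sp_mx t.
Proof.
split=> [[/psd_spmx[U [d [Uu d0 ->]]]]|[t [/unitarymxP tu t0 tM] ->]].
  rewrite mxtrace_spmx//= => dM; have [t [tU td]] := spcoord_of U d.
  exists t; last by rewrite /sp_mx tU td.
  by split; rewrite ?tU ?td//; exact/unitarymxP.
by split; [exact: spmx_psd | rewrite mxtrace_spmx].
Qed.

Lemma spectrahedron_sum M (N : nat) (X : 'I_N -> 'M[C]_n) (v : 'rV[R]_N) :
  (forall i, spectrahedron M (X i)) -> simplex v ->
  spectrahedron M (\sum_i (v 0 i)%:C *: X i).
Proof.
move=> XK [v0 v1]; split.
  by apply: psd_sum => i; apply: psdZ => //; exact: (XK i).1.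
rewrite (raddf_sum (@mxtrace C n)) [X in X <= _]raddf_sum /=.
have -> : M = \sum_i v 0 i * M by rewrite -mulr_suml v1 mul1r.
apply: ler_sum => i _; rewrite mxtraceZ.
have -> : complex.Re ((v 0 i)%:C * \tr (X i)) = v 0 i * complex.Re (\tr (X i)).
  by case: (\tr _) => a b /=; rewrite mul0r subr0.
by rewrite ler_wpM2l//; exact: (XK i).2.
Qed.

End Spectrahedron.

HB.instance Definition _ (T U : ptopologicalType) := Topological.on (T * U)%type.

(** * The real trace pairing *)

Section Pairing.
Variables (R : realType) (n : nat).
Implicit Types A B X Y : 'M[R[i]]_n.

(** On Hermitian matrices this is the Frobenius inner product; the real part makes it real-valued
    for all matrices. *)
Definition repairing A X : R := complex.Re (\tr (A *m X)).

Lemma continuous_repairing (T : topologicalType) (f h : T -> 'M[R[i]]_n) :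
  mxcontinuous f -> mxcontinuous h -> continuous (fun x => repairing (f x) (h x)).
Proof. by move=> fc hc; apply/continuous_Re_mxtrace/mxcontinuousM. Qed.

Lemma repairingB A X Y : repairing A (X - Y) = repairing A X - repairing A Y.
Proof. by rewrite /repairing mulmxBr !raddfB. Qed.

Lemma repairing_sum (N : nat) A (v : 'rV[R]_N) (X : 'I_N -> 'M[R[i]]_n) :
  repairing A (\sum_i (v 0 i)%:C *: X i) = \sum_i v 0 i * repairing A (X i).
Proof.
rewrite /repairing mulmx_sumr (raddf_sum (@mxtrace R[i] n)) [LHS]raddf_sum /=.
apply: eq_bigr => i _; rewrite -scalemxAr mxtraceZ.
by case: (\tr _) => a b /=; rewrite mul0r subr0.
Qed.

Lemma repairingBl A B X : repairing (A - B) X = repairing A X - repairing B X.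
Proof. by rewrite /repairing mulmxBl !raddfB. Qed.

Lemma Re_mul_real (a : R) (z : R[i]) : complex.Re (a%:C * z) = a * complex.Re z.
Proof. by case: z => x y /=; rewrite mul0r subr0. Qed.

Lemma repairingZl (a : R) A X : repairing (a%:C *: A) X = a * repairing A X.
Proof. by rewrite /repairing -scalemxAl mxtraceZ Re_mul_real. Qed.

Lemma repairingZr (a : R) A X : repairing A (a%:C *: X) = a * repairing A X.
Proof. by rewrite /repairing -scalemxAr mxtraceZ Re_mul_real. Qed.

End Pairing.

Section VariationalInequality.
Variables (R : realType) (n : nat) (M : R).
(** Continuity of [G] is expressed by a lift [g] to coordinates, which has to agree with it only on
    [spcoord_le M]. *)
Variables (G : 'M[R[i]]_n -> 'M[R[i]]_n).
Variable g : spcoord R n -> 'M[R[i]]_n.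
Hypotheses (gc : mxcontinuous g)
  (gE : forall t, spcoord_le M t -> g t = G (sp_mx t)).

(* The label [j] is allowed at [v] when [X j] minimizes the pairing with
   [G (\sum_i v_i X_i)]; the coordinates of this point are projected away. *)
Lemma finite_vi (N : nat) (X : 'I_N.+2 -> 'M[R[i]]_n) :
  (forall i, spectrahedron M (X i)) ->
  exists2 A, spectrahedron M A & forall i, repairing (G A) A <= repairing (G A) (X i).
Proof.
move=> XK; pose comb (v : 'rV[R]_N.+2) := \sum_i (v 0 i)%:C *: X i.
have combK v : simplex v -> spectrahedron M (comb v) by exact: spectrahedron_sum.
(* Weights [v] are paired with coordinates of the matrix [comb v], since [g] is defined on
   coordinates; [L j] is then closed as the projection of a compact set. *)
pose Z j := [set p | [/\ simplex p.1, spcoord_le M p.2, sp_mx p.2 - comb p.1 = 0 &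
  forall i, 0 <= repairing (g p.2) (X i) - repairing (g p.2) (X j)]].
pose L j := fst @` Z j.
have cfst i : continuous (fun p : 'rV[R]_N.+2 * spcoord R n => p.1 0 i).
  move=> p; apply: (@continuous_comp _ _ _ fst (fun v : 'rV[R]_N.+2 => v 0 i)).
    exact: cvg_fst.
  exact: coord_continuous.
have csnd m k (h : spcoord R n -> 'M[R[i]]_(m, k)) :
    mxcontinuous h ->
    mxcontinuous (fun p : 'rV[R]_N.+2 * spcoord R n => h p.2).
  move=> hc i j; have [h1 h2] := hc i j; split=> p.
    apply: (@continuous_comp _ _ _ snd (fun q => complex.Re (h q i j)));
      [exact: cvg_snd | exact: h1].
  apply: (@continuous_comp _ _ _ snd (fun q => complex.Im (h q i j)));
      [exact: cvg_snd | exact: h2].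
have Lcl j : closed (L j).
  apply: compact_closed; first exact: (@norm_hausdorff R 'rV[R]_N.+2).
  apply: continuous_compact.
    by apply: continuous_subspaceT => p; exact: cvg_fst.
  apply: (@subclosed_compact _ _ (@simplex R N.+2 `*` spcoord_le M)).
  - have -> : Z j = (@simplex R N.+2 `*` spcoord_le M) `&`
        ([set p | sp_mx p.2 - comb p.1 = 0] `&`
         \bigcap_i [set p | 0 <= repairing (g p.2) (X i) - repairing (g p.2) (X j)]).
      apply/seteqP; split=> p /=.
        by move=> [? ? ? h]; split=> //; split=> // i _; exact: h.
      by move=> [[? ?] [? h]]; split=> // i; exact: h.
    apply: closedI.
      apply: closedI; [apply: (preimage_closed (f := fst) (D := @simplex R N.+2)) |
          apply: (preimage_closed (f := snd) (D := @spcoord_le R n M))].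
      - by move=> p _; exact: cvg_fst.
      - exact: closed_simplex.
      - by move=> p _; exact: cvg_snd.
      - exact: closed_spcoord_le.
    apply: closedI.
      apply: closed_mxcontinuous_eq; apply: mxcontinuousB.
        exact/csnd/mxcontinuous_sp_mx.
      apply: mxcontinuous_sum => i; apply: mxcontinuousZ; last exact: mxcontinuous_cst.
      exact: ccontinuous_real.
    apply: closed_bigI => i _; apply: closed_ge_fun => p.
    by apply: cvgB; apply: continuous_repairing; (exact: csnd || exact: mxcontinuous_cst).
  - by apply: compact_setX; [exact: compact_simplex|exact: compact_spcoord_le].
  - by move=> p [].
have Lcov v : simplex v -> exists j, L j v.
  move=> vS; have [t tM vt] := (spectrahedronP _ _).1 (combK _ vS).
  have [j _ jmin] := Order.TotalTheory.arg_minP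
    (fun j => repairing (g t) (X j)) (isT : xpredT (ord0 : 'I_N.+2)).
  exists j; exists (v, t) => //; split=> //=; first by rewrite vt subrr.
  by move=> i; rewrite subr_ge0 jmin.
have [v vS vL] := dual_kkm Lcl Lcov.
exists (comb v); first exact: combK.
(* The pairing at [comb v] is the average of those with the [X j], and every [j] of nonzero weight
   is a minimizer. *)
move=> i; rewrite [X in X <= _]repairing_sum.
have -> : repairing (G (comb v)) (X i) = \sum_j v 0 j * repairing (G (comb v)) (X i).
  by rewrite -mulr_suml vS.2 mul1r.
apply: ler_sum => j _; have [->|vj] := eqVneq (v 0 j) 0; first by rewrite !mul0r.
have [[w t] [/= _ tM E hmin] wv] := vL j vj; rewrite /= in wv; rewrite wv in E.
have -> : G (comb v) = g t by rewrite gE// -(subr0_eq E).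
by rewrite ler_wpM2l ?vS.1// -subr_ge0.
Qed.

(** Each test matrix cuts out a closed subset of the compact [spcoord_le M], and [finite_vi]
    provides the finite intersection property. *)
Theorem spectrahedron_vi : 0 <= M ->
  exists2 A, spectrahedron M A &
    forall X, spectrahedron M X -> repairing (G A) A <= repairing (G A) X.
Proof.
move=> M0; pose K := [set X | @spectrahedron R n M X].
pose F X := spcoord_le M `&` [set t | 0 <= repairing (g t) (X - sp_mx t)].
have K0 : K 0 by split; [exact: psd0 | rewrite mxtrace0].
have cpt := @compact_spcoord_le R n M; rewrite compact_In0 in cpt.
have [|D' D'K|t tF] := cpt _ K F.
- exists (fun X => [set t | 0 <= repairing (g t) (X - sp_mx t)]) => // X _.
  apply/closed_ge_fun/continuous_repairing => //; apply: mxcontinuousB.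
    exact: mxcontinuous_cst.
  exact: mxcontinuous_sp_mx.
(* Two leading zeros supply the two test matrices that [finite_vi] needs at least. *)
- pose s : seq 'M[R[i]]_n := 0 :: 0 :: enum_fset D'.
  have sK i : K (nth 0 s i).
    have [si|/(nth_default 0) ->//] := ltnP i (size s).
    have : nth 0 s i \in s by exact: mem_nth.
    by rewrite !inE => /or3P[/eqP->|/eqP->|/D'K]//; rewrite inE.
  have [A /spectrahedronP[t tM AE] Amin] := finite_vi (fun i : 'I_(size (enum_fset D')).+2 => sK i).
  exists t => X XD; split=> //=; rewrite gE// -AE repairingB subr_ge0.
  have Xs : (index X s < (size (enum_fset D')).+2)%N.
    by rewrite -[X in (_ < X)%N]/(size s) index_mem !inE XD !orbT.
  by have := Amin (Ordinal Xs); rewrite /= nth_index// -index_mem.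
- have [tM _] := tF 0 K0; exists (sp_mx t); first by apply/spectrahedronP; exists t.
  move=> X XK; have [_ /=] := tF X XK.
  by rewrite repairingB subr_ge0 gE.
Qed.

End VariationalInequality.

(** * Solvability *)

Section PowerWord.
Variables (R : realType) (n k : nat) (p : nat -> R) (Q : nat -> 'M[R[i]]_n).
Hypotheses (p_gt0 : forall i, 0 < p i) (Q_pos : forall i, posdefmx (Q i)).
Hypothesis pal : palindrome k p Q.

Definition power_word (A : 'M[R[i]]_n) := word k (fun i => mxpowR A (p i)) Q.

Lemma palindrome_power (A : 'M[R[i]]_n) : palindrome k (fun i => mxpowR A (p i)) Q.
Proof.
split; last exact: pal.2.
by move=> i /pal.1 ->.
Qed.

Lemma power_word_herm A : psdmx A -> (power_word A)^t* = power_word A.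
Proof.
move=> /psd_spmx[U [d [Uu d0 ->]]]; apply: word_herm => [i|i|].
- by rewrite (spmx_powR _ _ Uu); exact: spmx_herm.
- by have /posdefmxP[] := Q_pos i.
- exact: palindrome_power.
Qed.

(** A positive power of an eigenvalue vanishes exactly when the eigenvalue does. *)
Lemma spmx_powR_mul_eq0 (U : 'M[R[i]]_n) (d : 'rV[R]_n) a (y : 'cV[R[i]]_n) :
  U \is unitarymx -> 0 < a ->
  spmx U (map_mx (@powR R ^~ a) d) *m y = 0 <-> spmx U d *m y = 0.
Proof.
move=> Uu a0; apply: iff_trans (spmx_mul_eq0 _ _ Uu) (iff_trans _ (iff_sym (spmx_mul_eq0 _ _ Uu))).
split=> h i; have := h i; rewrite [map_mx _ _ 0 i]mxE.
  by case=> [/eqP|]; [rewrite powR_eq0 => /andP[/eqP]; left | right].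
by case=> [->|]; [rewrite (powR0 (lt0r_neq0 a0)); left | right].
Qed.

Lemma power_word_qform_gt0 A (y : 'cV_n) : psdmx A -> A *m y != 0 ->
  0 < qform (power_word A) y.
Proof.
move=> /psd_spmx[U [d [Uu d0 AE]]]; rewrite AE => yA.
have powE i : mxpowR (spmx U d) (p i) = spmx U (map_mx (@powR R ^~ (p i)) d).
  exact: spmx_powR.
refine (word_qform_gt0 _ Q_pos _ _ (palindrome_power _) yA) => [i|i z|i z];
  rewrite powE.
- exact: spmx_herm.
- exact: (spmx_powR_mul_eq0 _ _ Uu (p_gt0 i)).2.
- move=> h; apply: (qform_spmx_gt0 Uu) => [j|]; first by rewrite mxE powR_ge0.
  by apply: contra_neq h; exact: (spmx_powR_mul_eq0 _ _ Uu (p_gt0 i)).1.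
Qed.

Lemma power_word_mul_eq0 A (y : 'cV_n) : psdmx A -> A *m y = 0 ->
  power_word A *m y = 0.
Proof.
move=> /psd_spmx[U [d [Uu d0 ->]]] h; rewrite /power_word /word -mulmxA (spmx_powR _ _ Uu).
by rewrite ((spmx_powR_mul_eq0 _ _ Uu (p_gt0 k)).2 h) mulmx0.
Qed.

Lemma spmxZ (U : 'M[R[i]]_n) (d : 'rV[R]_n) a : spmx U (a *: d) = a%:C *: spmx U d.
Proof.
rewrite /spmx scalemxAl scalemxAr; congr (_ *m _ *m _).
by apply/matrixP => i j; rewrite !mxE rmorphM mulrnAr.
Qed.

Lemma power_wordZ A a : psdmx A -> 0 < a ->
  power_word (a%:C *: A) = (a `^ (\sum_(i < k.+1) p i))%:C *: power_word A.
Proof.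
move=> /psd_spmx[U [d [Uu d0 ->]]] a0; rewrite -spmxZ.
have -> : a `^ (\sum_(i < k.+1) p i) = \prod_(i < k.+1) a `^ p i.
  elim: k => [|m IH]; first by rewrite !big_ord1.
  rewrite big_ord_recr [RHS]big_ord_recr /= powRD; first by rewrite IH.
  by rewrite (gt_eqF a0) implybT.
transitivity (word k (fun i => (a `^ p i)%:C *: mxpowR (spmx U d) (p i)) Q);
  last exact: word_scale.
apply: eq_word => // i _.
rewrite !(spmx_powR _ _ Uu) -spmxZ; congr spmx.
by apply/rowP => j; rewrite !mxE (powRM _ (ltW a0) (d0 j)).
Qed.

(** The continuous lift of [power_word]: absolute values keep it continuous at all coordinates and
    change nothing on nonnegative spectra. *)
Definition coord_word (t : spcoord R n) :=
  word k (fun i => spmx (sp_basis t) (\row_j (`|t.2 0 j| `^ p i))) Q.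

Lemma mxcontinuous_coord_word : mxcontinuous coord_word.
Proof.
apply: mxcontinuous_word => i; apply: mxcontinuous_spmx.
  exact: mxcontinuous_sp_basis.
move=> j; under eq_fun do rewrite mxE.
move=> t; apply: (@continuous_comp _ _ _ (fun t : spcoord R n => t.2 0 j)
  (fun x : R => `|x| `^ p i)).
  exact: continuous_spectrum.
exact: continuous_norm_powR.
Qed.

Lemma coord_wordE M t : spcoord_le M t -> coord_word t = power_word (sp_mx t).
Proof.
move=> [/unitarymxP tu t0 _]; apply: eq_word => i _ //.
rewrite (spmx_powR _ _ tu); congr spmx; apply/rowP => j; rewrite !mxE.
by rewrite (ger0_norm (t0 j)).
Qed.

(** In an eigenbasis [tr (S(A) A)] is the sum of [d_i u_i^* S(A) u_i]. If [d_i > 0] then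
    [A u_i != 0] and the term is positive; a positive trace provides such an [i]. *)
Lemma repairing_power_word_gt0 A : psdmx A -> 0 < complex.Re (\tr A) ->
  0 < repairing (power_word A) A.
Proof.
move=> Apsd; have [U [d [Uu d0 AE]]] := psd_spmx Apsd.
rewrite {1}AE mxtrace_spmx//= => dpos; rewrite /repairing {2}AE mxtrace_mul_spmx raddf_sum /=.
have q0 i : 0 < d 0 i -> 0 < complex.Re (qform (power_word A) (col i U)).
  move=> di; suff : 0 < qform (power_word A) (col i U) by rewrite ltcE => /andP[].
  apply: power_word_qform_gt0 => //; apply: contraTneq di => Ay.
  rewrite -ltcR -(qform_spmx_col d i Uu) -AE /qform -mulmxA Ay mulmx0 mxE.
  by rewrite -[X in X < _]/(0 : R[i]) ltxx.
have t0 i : 0 <= complex.Re ((d 0 i)%:C * qform (power_word A) (col i U)).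
  rewrite Re_mul_real; have [->|di] := eqVneq (d 0 i) 0; first by rewrite mul0r.
  by rewrite mulr_ge0// ltW// q0// lt_neqAle eq_sym di d0.
rewrite lt_neqAle sumr_ge0// andbT eq_sym; apply: contraTneq dpos => /eqP.
rewrite psumr_eq0// => /allP h; rewrite -leNgt; apply: sumr_le0 => i _.
have /= := h i (mem_index_enum _); rewrite Re_mul_real mulf_eq0 leNgt.
by move=> /orP[/eqP->|/eqP q]; [rewrite ltxx | apply/negP => /q0; rewrite q ltxx].
Qed.

(* [tr (S(A) A)] is positive on the compact slice [tr A = 1] and homogeneous of
   degree [1 + s], so it outgrows the linear form [tr (P A)]. *)
Lemma power_word_coercive (P : 'M[R[i]]_n) : (0 < n)%N -> exists2 M, 0 < M &
  forall A, psdmx A -> complex.Re (\tr A) = M ->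
    repairing P A < repairing (power_word A) A.
Proof.
move=> n0; pose slice := spcoord_le 1 `&`
  [set t : spcoord R n | \sum_i t.2 0 i = 1].
have slice_c : compact slice.
  apply: (subclosed_compact _ (@compact_spcoord_le R n 1)); last by move=> t [].
  apply: closedI; first exact: closed_spcoord_le.
  by apply/closed_eq_fun/continuous_sum/continuous_spectrum.
(* A diagonal matrix unit lies in the slice; it exists because [0 < n]. *)
have slice0 : slice !=set0.
  have [t [tU td]] := spcoord_of 1%:M (\row_i (i == Ordinal n0)%:R : 'rV[R]_n).
  have s1 : \sum_i t.2 0 i = 1.
    rewrite td (bigD1 (Ordinal n0))//= mxE eqxx big1 ?addr0// => i ni.
    by rewrite mxE (negPf ni).
  exists t; split; rewrite /= ?s1//; split=> [|i|]; rewrite ?s1//.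
    by rewrite tU trmx1 map_mx1 mulmx1.
  by rewrite td mxE ler0n.
have Wc : {within slice, continuous (fun t => repairing (coord_word t) (sp_mx t))}.
  apply/continuous_subspaceT/continuous_repairing; first exact: mxcontinuous_coord_word.
  exact: mxcontinuous_sp_mx.
have Pc : {within slice, continuous (fun t => repairing P (sp_mx t))}.
  apply/continuous_subspaceT/continuous_repairing; first exact: mxcontinuous_cst.
  exact: mxcontinuous_sp_mx.
have [t0 /set_mem[t0M t01] Wmin] := compact_EVT_min slice0 slice_c Wc.
have [t1 _ Pmax] := compact_EVT_max slice0 slice_c Pc.
(* On the slice, [c] is the minimum of [tr (S(A) A)] and [m] the maximum of [tr (P A)]. *)
set c := repairing _ _ in Wmin; set m := repairing _ _ in Pmax.
have c0 : 0 < c.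
  have [/unitarymxP tu d0 _] := t0M.
  rewrite /c (coord_wordE t0M); apply: repairing_power_word_gt0; first exact: spmx_psd.
  by rewrite mxtrace_spmx//= t01.
set s := \sum_(i < k.+1) p i.
have s0 : 0 < s.
  by rewrite /s big_ord_recl ltr_pwDl// sumr_ge0// => i _; apply: ltW.
(* Chosen so that [b * c = |m| + 1 > m]; the trace bound [M] then satisfies [M^s = b]. *)
pose b := (`|m| + 1) / c.
have b0 : 0 < b by rewrite divr_gt0// ltr_wpDl.
exists (b `^ s^-1); first exact: powR_gt0.
set M := b `^ s^-1; have M0 : 0 < M by exact: powR_gt0.
have Ms : M `^ s = b by rewrite /M -powRrM mulVf ?gt_eqF// powRr1// ltW.
move=> A /psd_spmx[U [d [Uu d0 ->]]]; rewrite (mxtrace_spmx _ Uu) /= => dM.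
(* Rescaling to trace 1 divides [tr (P A)] by [M] and [tr (S(A) A)] by [M * M^s = M * b]. *)
have [t [tU td]] := spcoord_of U (M^-1 *: d).
have AE : spmx U d = M%:C *: sp_mx t.
  by rewrite /sp_mx tU td -spmxZ scalerA (divff (lt0r_neq0 M0)) scale1r.
have t1s : \sum_i t.2 0 i = 1.
  rewrite td; under eq_bigr do rewrite mxE; rewrite -mulr_sumr dM mulVf ?gt_eqF//.
have tM : spcoord_le 1 t.
  split; [by rewrite tU; exact/unitarymxP | move=> i | by rewrite t1s].
  by rewrite td mxE mulr_ge0// invr_ge0 ltW.
have ts : t \in slice by exact/mem_set.
have tpsd : psdmx (sp_mx t) by apply: spmx_psd; have [] := tM.
rewrite AE (power_wordZ tpsd M0) -/s Ms !repairingZr repairingZl (ltr_pM2l M0).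
apply: le_lt_trans (Pmax _ ts) _.
apply: (@lt_le_trans _ _ (b * c)); last first.
  by rewrite (ler_pM2l b0) -(coord_wordE tM); exact: Wmin.
by rewrite /b mulfVK ?gt_eqF// (le_lt_trans (ler_norm _))// ltrDl.
Qed.

Theorem power_word_surj (P : 'M[R[i]]_n) : (0 < n)%N -> posdefmx P ->
  exists2 A, posdefmx A & power_word A = P.
Proof.
move=> n0 Ppos; have [Ph P0] := (posdefmxP P).1 Ppos.
have [M M0 coercive] := power_word_coercive P n0.
have gc : mxcontinuous (fun t => coord_word t - P).
  by apply: mxcontinuousB; [exact: mxcontinuous_coord_word|exact: mxcontinuous_cst].
have gE t : spcoord_le M t -> coord_word t - P = power_word (sp_mx t) - P.
  by move=> tM; rewrite (coord_wordE tM).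
have [A [Apsd AM] Amin] := spectrahedron_vi (G := fun A => power_word A - P) gc gE (ltW M0).
rewrite /= in Amin; set G := power_word A - P in Amin.
have GA : repairing G A <= 0.
  apply: le_trans (Amin 0 _) _; last by rewrite /repairing mulmx0 mxtrace0.
  by split; [exact: psd0 | rewrite mxtrace0 ltW].
(* On the face [tr A = M] coercivity would give [tr (G A) > 0]. *)
have {AM}AM : complex.Re (\tr A) < M.
  rewrite lt_neqAle AM andbT; apply/eqP => /(coercive _ Apsd).
  by rewrite -subr_gt0 -repairingBl ltNge GA.
have Gh : G^t* = G.
  by rewrite /G linearB /= map_mxB power_word_herm// Ph.
have Gq y : 0 <= complex.Re (qform G y).
  have [yp yh] := psd_rank1 y; set Y := y *m y^t* in yp yh.
  have [W [e [Wu e0 YE]]] := psd_spmx (psd_rank1 y).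
  have trY : 0 <= complex.Re (\tr Y) by rewrite /Y YE mxtrace_spmx//= sumr_ge0.
  (* This makes [a * tr Y <= M - tr A], so [A + a Y] is admissible; the added 1 keeps the
     denominator positive when [y = 0]. *)
  pose a := (M - complex.Re (\tr A)) / (complex.Re (\tr Y) + 1).
  have a0 : 0 < a by rewrite divr_gt0 ?subr_gt0// ltr_wpDl.
  have := Amin (A + a%:C *: Y); rewrite -[qform G y]mxtrace_rank1 -/Y.
  have -> : repairing G (A + a%:C *: Y) = repairing G A + a * repairing G Y.
    by rewrite -repairingZr /repairing mulmxDr !raddfD.
  rewrite lerDl (pmulr_rge0 _ a0); apply; split; first by apply/psdD/psdZ/psd_rank1/ltW.
  rewrite mxtraceD mxtraceZ raddfD /= Re_mul_real -lerBrDl /a.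
  rewrite mulrAC ler_pdivrMr ?ltr_wpDl// ler_pM2l ?subr_gt0// lerDl ler01//.
(* Evaluating on eigenvectors turns the bound on real parts into nonnegative eigenvalues. *)
have Gpsd : psdmx G.
  have [V [e [Vu GE]]] := herm_spmx Gh; rewrite GE; apply: spmx_psd => i.
  by have := Gq (col i V); rewrite GE qform_spmx_col.
have Apos : posdefmx A.
  have [U [d [Uu d0 AE]]] := psd_spmx Apsd; rewrite AE; apply: spmx_posdef => // i.
  (* For an eigenvector [y] of eigenvalue 0, [S(A) y = 0] and so [y^* G y = - y^* P y < 0]. *)
  rewrite lt_neqAle d0 andbT; apply/eqP => di.
  have y0 := unitarymx_col_neq0 i Uu; set y := col i U in y0.
  have Ay : A *m y = 0.
    have [//|] := eqVneq (A *m y) 0; rewrite AE => /(qform_spmx_gt0 Uu d0).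
    by rewrite (qform_spmx_col d i Uu) ltcR -di ltxx.
  have := Gpsd.2 y; rewrite /G qformD {1}/qform -mulmxA power_word_mul_eq0// mulmx0 mxE add0r.
  by rewrite -scaleN1r qformZ mulN1r oppr_ge0 => /le_gtF; rewrite (P0 _ y0).
exists A; [exact: Apos | apply: subr0_eq].
exact: (psd_orth_posdef Gpsd Apos GA).
Qed.

End PowerWord.

Theorem theorem2p2 (R : realType) (S : gexpr R)
    (S_gword : is_gword S) (S_sym : gw_symmetric S) (S_pos : gw_Apositive S)
    (n : nat) (n_gt0 : (1 <= n)%N) (B P : 'M[complex R]_n)
    (B_pos : posdefmx B) (P_pos : posdefmx P) :
  exists A : 'M[complex R]_n, posdefmx A /\ gw_eval S A B = P.
Proof.
have [symA symB] := (gw_symmetricP S).1 S_sym.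
(* [inord] always lands in range, so [p] is positive on all of [nat]. *)
pose p i := gw_A S (inord i).
(* There may be no [B] exponent at all, hence the default 0; [mxpowR B 0] is still positive
   definite. *)
pose q i := if insub i is Some j then gw_B S j else 0.
have pal : palindrome (gw_len S) p (fun i => mxpowR B (q i)).
  split=> i ik.
    rewrite /p -symA; congr (gw_A S _); apply: val_inj => /=.
    by rewrite !inordK ?subSS ?subKn// ltnS leq_subr.
  have ik' : ((gw_len S).-1 - i < gw_len S)%N by lia.
  congr mxpowR; rewrite /q !insubT -[RHS]symB; congr (gw_B S _); apply: val_inj => /=.
  by lia.
have [A Apos AE] := power_word_surj (fun i => S_pos (inord i))
  (fun i => posdef_powR (q i) B_pos) pal n_gt0 P_pos.
have pE (i : 'I_(gw_len S).+1) : gw_A S i = p i by rewrite /p inord_val.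
have qE (i : 'I_(gw_len S)) : gw_B S i = q i.
  by rewrite /q insubT//= => ik; congr (gw_B S _); apply: val_inj.
exists A; split; first exact: Apos.
rewrite -AE /gw_eval pE; apply: (congr1 (mulmx^~ _)).
by apply: eq_bigr => i _; rewrite pE qE.
Qed.
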